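(* Let $F\in\mathbb Z[X]$ be irreducible of degree $g\ge2$, and let $\Psi_F(x,y):=\#\{n\le x:\ F(n)\ne0,\ P^+(|F(n)|)\le y\}$, where $n$ runs over positive integers. Put $u:=\frac{\log x}{\log y}$. Then $$\Psi_F(x,y)\ \ge\ \{1+u-gu+o(1)\}\,x$$ as $x\to\infty$, provided $x^{g-1}<y\le x^g$, i.e. $u\in\left[\frac1g,\frac1{g-1}\right)$.
   Context: $P^+(n)$ denotes the largest prime factor of $n\ge1$, with $P^+(1):=1$. The polynomial $F$ is fixed as $x\to\infty$. *)

(* Defs.v *)
From mathcomp Require Import all_boot all_order all_algebra.
From mathcomp Require Import all_classical all_reals all_analysis.

Set Implicit Arguments.
Unset Strict Implicit.
Unset Printing Implicit Defensive.

Import Order.TTheory GRing.Theory Num.Theory.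
Local Open Scope ring_scope.

(* [max_pdiv 1 = 1].  For [x >= 0], [Num.truncn x] is the integer part of [x],
   so the indices are the positive integers [n <= x]; for [x < 1] there are
   none and the count is [0]. *)
Definition Psi (R : realType) (F : {poly int}) (x y : R) : nat :=
  count (fun n : nat =>
           (F.[n%:Z] != 0) && ((max_pdiv `|F.[n%:Z]|%N)%:R <= y))
        (index_iota 1 (Num.truncn x).+1).

(* On [{poly int}], [irreducible_poly] uses pseudo-division, hence ignores
   integer content: it is irreducibility in Q[X] ([irreducible_rat_int]).
   Irreducible elements of Z[X] of positive degree satisfy it. *)
Lemma ring_irreducible_poly_int (F : {poly int}) : (1 < size F)%N ->
  (forall G H : {poly int}, F = G * H ->
     G \is a GRing.unit \/ H \is a GRing.unit) ->
  irreducible_poly F.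
Proof.
move=> sF irrF; split=> // q sq /dvdpP_int [r Fqr].
have /orP[] : (zprimitive q \is a GRing.unit) || (r \is a GRing.unit).
- by apply/orP; apply: irrF.
- by rewrite poly_unitE size_zprimitive (negbTE sq).
rewrite poly_unitE => /andP[/size_poly1P [c c0 rc] _].
have q0 : q != 0.
  by apply: contraTneq sF => q0; rewrite Fqr q0 zprimitive0 mul0r size_poly0.
rewrite Fqr rc mulrC mul_polyC {1}[q]zpolyEprim.
apply: (eqp_trans (eqp_scale _ _)); first by rewrite zcontents_eq0.
by rewrite eqp_sym eqp_scale.
Qed.

(* Main.v *)
(* By Chebyshev's device, if Psi misses B integers n <= x then
     B log y + sum_(p <= z) log p #{n <= x : p | F(n)} <= sum_(n <= x) log |F(n)|
   with z a small multiple of x, and the right-hand side is g x log x + O(x).  It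
   remains to see that the primes p <= z contribute at least (1 - o(1)) x log x,
   i.e. that sum_(p <= z) rho(p) log p / p >= (1 - o(1)) log z, where rho(p)
   counts the roots modulo p.

   This half of Mertens' theorem for the field Q[X]/(F) follows from the same
   device applied to norms.  Make F monic and let N(a) be the norm of an element
   a = a_0 + ... + a_(g-1) theta^(g-1).  Let a run over a box of side X, translated
   so that N(a) >= X^g and dilated by W so that N(a) is prime to all p <= K and to
   the discriminant.  Outside a set of density O(1/K), N(a) is squarefree; then
   every p dividing N(a) comes with a root r of F modulo p such that p | a(r).
   Hence log N(a) is the sum of log p over such p, and the set of a with
   p | a(r), being an ideal of index p, contains at most (1 + o(1)) X^g / p points
   of the box if p = o(X^g), and O(X^g / p) points otherwise. *)

Require Import Defs.
From mathcomp Require Import all_boot all_order all_algebra all_field.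
From mathcomp Require Import all_classical all_reals all_analysis.
From mathcomp Require Import zify ring lra.

Set Implicit Arguments.
Unset Strict Implicit.
Unset Printing Implicit Defensive.

Import Order.TTheory GRing.Theory Num.Theory.
Import numFieldNormedType.Exports.
Local Open Scope ring_scope.

(** No ideal theory enters: a norm is the determinant of a matrix, which makes sense over every
    commutative ring, and a prime ideal of degree one is a pair of [p] and a residue [r] with [p]
    dividing [G.[r]]. The box is counted in two ways. Differences of points of one class have
    nonzero norms divisible by [q], so they cannot be short; this packing argument loses a constant
    factor, which is affordable for square divisors and for the primes above [m^g]. The primes up to
    [m^g] demand the constant 1, which comes from packing disjoint translates of the class instead.
    Each class of the first kind also has an additive error [O(1)]; since norms are [O(X^g)] and
    [g >= 2], testing [p^2] for [p] up to [O(X^(g-1))] suffices, and these errors add up to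
    [o(X^g)]. The final exponent arises from [B log y <= (g - 1 + o(1)) x log x]: dividing by
    [log y] gives [B <= ((g - 1) u + o(1)) x], as [u] stays bounded. *)

(** * Norms as determinants over a commutative ring *)

Definition companion (R : comNzRingType) n (G : {poly R}) : 'M[R]_n.+1 :=
  \matrix_(i, j) if i == n :> nat then - G`_j else (j == i.+1 :> nat)%:R.

(* Multiplication by [sum_k a_k X^k] on [R[X] / (G)] in the basis [1, X, ..., X^n]
   (acting on row vectors); its determinant is the norm of that element. *)
Definition opmx (R : comNzRingType) n (G : {poly R}) (a : 'rV[R]_n.+1) :=
  \sum_(k < n.+1) a 0 k *: companion n G ^+ k.

Definition ev (R : comNzRingType) n (a : 'rV[R]_n.+1) (x : R) :=
  \sum_(k < n.+1) a 0 k * x ^+ k.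

Definition powcol (R : comNzRingType) n (x : R) : 'cV[R]_n.+1 :=
  \col_k x ^+ k.

Lemma companion_powcol (R : comNzRingType) n (G : {poly R}) (x : R) :
  G \is monic -> size G = n.+2 -> G.[x] = 0 ->
  companion n G *m powcol n x = x *: powcol n x.
Proof.
move=> mG sG Gx; apply/matrixP => i j; rewrite !mxE.
under eq_bigr do rewrite !mxE.
case: eqP => [-> | /eqP ni].
- have /eqP := Gx; rewrite horner_coef sG big_ord_recr /=.
  move/monicP: mG; rewrite lead_coefE sG /= => ->; rewrite mul1r addr_eq0.
  move/eqP; rewrite -exprS => e.
  rewrite -[RHS]opprK -e -sumrN; apply: eq_bigr => k _; by rewrite mulNr.
- have lti : (i.+1 < n.+1)%N by rewrite ltn_neqAle eqSS ni ltn_ord.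
  rewrite (bigD1 (Ordinal lti)) //= eqxx mul1r exprS big1 ?addr0 // => k nk.
  by case: eqP => [e|]; rewrite ?mul0r //; case/eqP: nk; apply: val_inj.
Qed.

Lemma companionX_eigen (R : comNzRingType) n (C : 'M[R]_n.+1) (u : 'cV[R]_n.+1)
  (x : R) k : C *m u = x *: u -> C ^+ k *m u = x ^+ k *: u.
Proof.
move=> e; elim: k => [|k IH]; first by rewrite !expr0 mul1mx scale1r.
by rewrite exprS -mulmxA IH -scalemxAr e scalerA -exprSr.
Qed.

Lemma opmx_eigen (R : comNzRingType) n (G : {poly R}) (a : 'rV[R]_n.+1)
    (u : 'cV[R]_n.+1) (x : R) :
  companion n G *m u = x *: u -> opmx G a *m u = ev a x *: u.
Proof.
move=> e; rewrite /opmx mulmx_suml /ev scaler_suml; apply: eq_bigr => k _.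
by rewrite -scalemxAl (companionX_eigen _ e) scalerA.
Qed.

Lemma opmx_powcol (R : comNzRingType) n (G : {poly R}) (a : 'rV[R]_n.+1) (x : R) :
  G \is monic -> size G = n.+2 -> G.[x] = 0 ->
  opmx G a *m powcol n x = ev a x *: powcol n x.
Proof. by move=> mG sG Gx; apply/opmx_eigen/companion_powcol. Qed.

Lemma opmx_comm (R : comNzRingType) n (G : {poly R}) (a : 'rV[R]_n.+1) :
  companion n G *m opmx G a = opmx G a *m companion n G.
Proof.
rewrite /opmx mulmx_suml mulmx_sumr; apply: eq_bigr => k _.
by rewrite -scalemxAl -scalemxAr; congr (_ *: _); rewrite -[LHS]exprS -[RHS]exprSr.
Qed.

Lemma evB (R : comNzRingType) n (a b : 'rV[R]_n.+1) x :
  ev (a - b) x = ev a x - ev b x.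
Proof.
by rewrite /ev -sumrB; apply: eq_bigr => k _; rewrite !mxE mulrBl.
Qed.

Lemma evZ (R : comNzRingType) n (c : R) (a : 'rV[R]_n.+1) x :
  ev (c *: a) x = c * ev a x.
Proof.
by rewrite /ev mulr_sumr; apply: eq_bigr => k _; rewrite !mxE mulrA.
Qed.

Lemma map_companion (R S : comNzRingType) (f : {rmorphism R -> S}) n
    (G : {poly R}) : map_mx f (companion n G) = companion n (map_poly f G).
Proof.
apply/matrixP => i j; rewrite !mxE coef_map.
by case: ifP => _; rewrite ?rmorphN ?rmorph_nat.
Qed.

Lemma map_opmx (R S : comNzRingType) (f : {rmorphism R -> S}) n (G : {poly R})
    (a : 'rV[R]_n.+1) :
  map_mx f (opmx G a) = opmx (map_poly f G) (map_mx f a).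
Proof.
rewrite /opmx raddf_sum; apply: eq_bigr => k _.
by rewrite /= map_mxZ rmorphXn /= map_companion mxE.
Qed.

Lemma map_ev (R S : comNzRingType) (f : {rmorphism R -> S}) n (a : 'rV[R]_n.+1) x :
  f (ev a x) = ev (map_mx f a) (f x).
Proof.
by rewrite /ev rmorph_sum; apply: eq_bigr => k _; rewrite rmorphM rmorphXn mxE.
Qed.

(** Replacing row [j] by the first unit vector produces entry [(0, j)] of the adjugate as a
    determinant ([det_unitrow]). In this form it commutes with ring maps, and its invertibility
    forces a null vector of [M] with coordinate 0 equal to 0 to vanish. *)
Definition unitrow (R : comNzRingType) n (M : 'M[R]_n.+1) (j : 'I_n.+1) : 'M[R]_n.+1 :=
  \matrix_(k, l) if k == j then (l == 0)%:R else M k l.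

Lemma map_unitrow (R S : comNzRingType) (f : {rmorphism R -> S}) n (M : 'M[R]_n.+1) j :
  map_mx f (unitrow M j) = unitrow (map_mx f M) j.
Proof. by apply/matrixP => k l; rewrite !mxE; case: ifP; rewrite ?rmorph_nat. Qed.

Lemma det_unitrow (R : comNzRingType) n (M : 'M[R]_n.+1) j :
  \det (unitrow M j) = \adj M 0 j.
Proof.
rewrite (expand_det_row _ j) (bigD1 0) //= big1 => [|l /negPf l0]; last first.
  by rewrite mxE eqxx l0 mul0r.
rewrite addr0 !mxE eqxx mul1r /cofactor; congr (_ * \det _).
by apply/matrixP => k l; rewrite !mxE eq_sym (negPf (neq_lift _ _)).
Qed.

Lemma unitrow_mul0 (R : comNzRingType) n (M : 'M[R]_n.+1) j (v : 'cV[R]_n.+1) :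
  M *m v = 0 -> v 0 0 = 0 -> unitrow M j *m v = 0.
Proof.
move=> Mv v0; apply/matrixP => k l; rewrite ord1 !mxE.
case: (eqVneq k j) => [-> | nkj].
- rewrite (bigD1 0) //= big1 => [|i /negPf i0]; last by rewrite mxE eqxx i0 mul0r.
  by rewrite v0 mulr0 addr0.
- have := congr1 (fun A : 'cV_ _ => A k 0) Mv; rewrite !mxE => e.
  by rewrite -[RHS]e; apply: eq_bigr => i _; rewrite mxE (negPf nkj).
Qed.

Lemma unit_det_inj (R : comUnitRingType) n (M : 'M[R]_n.+1) (v : 'cV[R]_n.+1) :
  \det M \is a GRing.unit -> M *m v = 0 -> v = 0.
Proof.
move=> uM Mv; rewrite -[v]mul1mx -[1%:M](@mulVmx _ _ M) ?unitmxE //.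
by rewrite -mulmxA Mv mulmx0.
Qed.

(* The column [u] of the adjugate spans the kernel of [opmx G a], which the
   companion matrix preserves; the eigenvalue is the root. *)
Lemma adj_root (R : comUnitRingType) n (G : {poly R}) (a : 'rV[R]_n.+1) j :
  G \is monic -> size G = n.+2 -> \det (opmx G a) = 0 ->
  \det (unitrow (opmx G a) j) \is a GRing.unit ->
  exists r, G.[r] = 0 /\ ev a r = 0.
Proof.
move=> mG sG detM uM; set M := opmx G a in detM uM *.
pose C := companion n G; pose u := col j (\adj M).
have Mu : M *m u = 0.
  rewrite /u colE mulmxA mul_mx_adj detM; apply/matrixP => k l.
  by rewrite -scalemx1 scale0r mul0mx mxE.
have u0E : u 0 0 = \det (unitrow M j) by rewrite det_unitrow mxE.
clearbody u.
have [r rE] : exists r, r = (C *m u) 0 0 / u 0 0 by eexists.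
(* By the choice of [r], coordinate 0 of [C *m u - r *: u] is 0. As [C] commutes with [M], this is
   also a null vector of [M], so it is killed by the injective matrix [unitrow M j]. *)
have Cu : C *m u = r *: u.
  apply/eqP; rewrite -subr_eq0; apply/eqP/(unit_det_inj uM)/unitrow_mul0.
    by rewrite mulmxBr mulmxA -opmx_comm -mulmxA Mu mulmx0 -scalemxAr Mu scaler0 subrr.
  by rewrite [LHS]mxE [X in _ + X]mxE [X in - X]mxE rE divrK ?subrr ?u0E.
(* The first [n] rows of [C] are a shift, so the eigenvector is a geometric progression of ratio
   [r]; the last row then yields [G.[r] = 0]. *)
have uk k : (k <= n)%N -> forall i : 'I_n.+1, i = k :> nat -> u i 0 = r ^+ k * u 0 0.
  elim: k => [_ i i0|k IH lk i ik].
    by rewrite mul1r; congr (u _ _); apply: val_inj.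
  have ltk : (k < n.+1)%N by rewrite ltnS ltnW.
  have := congr1 (fun A : 'cV_ _ => A (Ordinal ltk) 0) Cu.
  rewrite [RHS]mxE (IH (ltnW lk) (Ordinal ltk)) // exprS -mulrA => <-; rewrite mxE.
  rewrite (bigD1 i) //= big1 => [|l nl].
    by rewrite [companion _ _ _ _]mxE /= ltn_eqF // (introT eqP ik) mul1r addr0.
  rewrite [C _ _]mxE /= ltn_eqF // (_ : (_ == _) = false) ?mul0r //.
  by apply/negP => /eqP e; case/eqP: nl; apply: val_inj; rewrite /= ik.
have u0n : u 0 0 \is a GRing.unit by rewrite u0E.
exists r; split; last first.
  have := congr1 (fun A : 'cV_ _ => A 0 0) Mu.
  rewrite (opmx_eigen _ Cu) [LHS]mxE [RHS]mxE => e.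
  by rewrite -[LHS](mulrK u0n) e mul0r.
have := congr1 (fun A : 'cV_ _ => A ord_max 0) Cu.
rewrite !mxE.
under eq_bigr => k _ do rewrite !mxE /= eqxx (uk k (leq_ord k)) // mulrA.
rewrite (uk n (leqnn n) ord_max) // mulrA -exprS -mulr_suml => /(mulIr u0n) e.
rewrite horner_coef sG big_ord_recr /=.
move/monicP: mG; rewrite lead_coefE sG /= => ->; rewrite mul1r -e.
by rewrite -big_split big1 //= => k _; rewrite mulNr subrr.
Qed.

(** * Norms over a field containing all the roots *)

Definition allroots (L : fieldType) n (G : {poly L}) (rho : 'I_n.+1 -> L) :=
  [/\ G \is monic, size G = n.+2, injective rho & forall i, G.[rho i] = 0].

Lemma Vandermonde_unit (L : fieldType) n (rho : 'I_n.+1 -> L) :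
  injective rho -> Vandermonde n.+1 (\row_i rho i) \in unitmx.
Proof.
move=> inj; rewrite unitmxE det_Vandermonde unitfE.
apply/prodf_neq0 => i _; apply/prodf_neq0 => j ij; rewrite !mxE subr_eq0.
by apply/eqP => /inj e; rewrite e ltnn in ij.
Qed.

Lemma opmx_Vandermonde (L : fieldType) n (G : {poly L}) (rho : 'I_n.+1 -> L) (a : 'rV[L]_n.+1) :
  allroots G rho ->
  opmx G a *m Vandermonde n.+1 (\row_i rho i) =
    Vandermonde n.+1 (\row_i rho i) *m diag_mx (\row_i ev a (rho i)).
Proof.
move=> [mG sG _ Grho]; apply/matrixP => k i.
have := congr1 (fun A : 'cV_ _ => A k 0) (opmx_powcol a mG sG (Grho i)).
rewrite mul_mx_diag !mxE mulrC => e; rewrite -[RHS]e.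
by apply: eq_bigr => l _; rewrite !mxE.
Qed.

Lemma det_opmx (L : fieldType) n (G : {poly L}) (rho : 'I_n.+1 -> L) (a : 'rV[L]_n.+1) :
  allroots G rho -> \det (opmx G a) = \prod_i ev a (rho i).
Proof.
move=> aG; have [_ _ inj _] := aG.
have uV := Vandermonde_unit inj.
have := congr1 determinant (opmx_Vandermonde a aG).
rewrite !det_mulmx det_diag mulrC => /mulrI; rewrite -unitmxE => /(_ uV) ->.
by apply: eq_bigr => i _; rewrite mxE.
Qed.

(** The difference of the null vectors [powcol n (rho i1)] and [powcol n (rho i2)] has coordinate 0
    equal to 0 but coordinate 1 nonzero, so no [unitrow] matrix is injective. *)
Lemma two_roots_unitrow (L : fieldType) n (G : {poly L}) (rho : 'I_n.+1 -> L) (a : 'rV[L]_n.+1) i1 i2 j :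
  allroots G rho -> i1 != i2 -> ev a (rho i1) = 0 -> ev a (rho i2) = 0 ->
  \det (unitrow (opmx G a) j) = 0.
Proof.
move=> [mG sG inj Grho] ni e1 e2; apply/eqP/contraT => dn0.
pose v := powcol n (rho i1) - powcol n (rho i2).
have v0 : v = 0.
  apply: (@unit_det_inj _ _ (unitrow (opmx G a) j)); first by rewrite unitfE.
  apply: unitrow_mul0; last by rewrite !mxE !expr0 subrr.
  by rewrite mulmxBr !opmx_powcol ?e1 ?e2 ?scale0r ?subrr.
have n1 : (1 < n.+1)%N.
  rewrite ltnS lt0n; apply: contraNneq ni => n0; apply/eqP/val_inj.
  by have := leq_ord i1; have := leq_ord i2; move/eqP: n0 => /=; lia.
have := congr1 (fun A : 'cV_ _ => A (Ordinal n1) 0) v0.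
rewrite !mxE /= !expr1 => /eqP; rewrite subr_eq0 => /eqP /inj e.
by rewrite e eqxx in ni.
Qed.

(** The kernel of [opmx G a] is the line of [powcol n (rho i)], whose coordinate 0 is 1. The index
    [j] is one where a left null vector [y] is nonzero: row [j] is then a combination of the other
    rows, and replacing it loses no equation. *)
Lemma one_root_unitrow (L : fieldType) n (G : {poly L}) (rho : 'I_n.+1 -> L) (a : 'rV[L]_n.+1) i :
  allroots G rho -> ev a (rho i) = 0 -> (forall j, j != i -> ev a (rho j) != 0) ->
  exists j, \det (unitrow (opmx G a) j) != 0.
Proof.
move=> aG ei nei; have [mG sG inj Grho] := aG.
have := opmx_Vandermonde a aG; have := Vandermonde_unit inj.
set V := Vandermonde _ _; set D := diag_mx _; set M := opmx G a => uV MV.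
have VD : invmx V *m M = D *m invmx V.
  by apply: (can_inj (mulmxK uV)); rewrite -!mulmxA MV mulKmx // mulVmx // mulmx1.
have Dk (B : 'cV[L]_n.+1) k : (D *m B) k 0 = ev a (rho k) * B k 0.
  by rewrite mul_diag_mx !mxE.
pose y := row i (invmx V).
have yM : y *m M = 0.
  rewrite -row_mul VD; apply/matrixP => k l; rewrite mul_diag_mx !mxE.
  by rewrite ei mul0r.
have /rV0Pn [j yj] : y != 0.
  apply/eqP => y00.
  have : row i (invmx V *m V) = 0 by rewrite row_mul -/y y00 mul0mx.
  rewrite mulVmx // => /matrixP /(_ 0 i); rewrite !mxE eqxx => /eqP.
  by rewrite oner_eq0.
exists j; apply/negP => /eqP d0.
have /det0P [w wn0 wU] : \det (unitrow M j)^T == 0 by rewrite det_tr d0.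
pose v := w^T.
have Uv : unitrow M j *m v = 0.
  by apply: trmx_inj; rewrite trmx_mul trmxK wU trmx0.
have Uvk k : (unitrow M j *m v) k 0 = if k == j then v 0 0 else (M *m v) k 0.
  rewrite !mxE; case: eqP => [->|/eqP/negPf nk]; last first.
    by apply: eq_bigr => l _; rewrite [unitrow _ _ _ _]mxE nk.
  rewrite (bigD1 0) //= big1 => [|l /negPf l0].
    by rewrite [unitrow _ _ _ _]mxE !eqxx mul1r addr0 !mxE.
  by rewrite [unitrow _ _ _ _]mxE eqxx l0 mul0r.
have v0 : v 0 0 = 0 by have := Uvk j; rewrite Uv eqxx mxE.
have Mvk k : k != j -> (M *m v) k 0 = 0.
  by move=> nk; have := Uvk k; rewrite Uv (negPf nk) mxE.
have Mv : M *m v = 0.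
  apply/matrixP => k l; rewrite ord1 [RHS]mxE; case: (eqVneq k j) => [->|/Mvk //].
  have : (y *m (M *m v)) 0 0 = 0 by rewrite mulmxA yM mul0mx mxE.
  rewrite mxE (bigD1 j) //= big1 => [|m nm]; last by rewrite Mvk ?mulr0.
  by rewrite addr0 => /eqP; rewrite mulf_eq0 (negPf yj) => /eqP.
pose c := invmx V *m v.
have vE : v = V *m c by rewrite mulKVmx.
have c0 k : k != i -> c k 0 = 0.
  move=> nk; have : (D *m c) k 0 = 0 by rewrite /c mulmxA -VD -mulmxA Mv mulmx0 mxE.
  by rewrite Dk => /eqP; rewrite mulf_eq0 (negPf (nei _ nk)) => /eqP.
have ci : c i 0 = 0.
  move: v0; rewrite vE mxE (bigD1 i) //= big1 => [|k nk]; last by rewrite c0 ?mulr0.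
  by rewrite addr0 !mxE expr0 mul1r.
have c00 : c = 0.
  by apply/matrixP => k l; rewrite ord1 [RHS]mxE; case: (eqVneq k i) => [->|/c0].
case/eqP: wn0; apply: trmx_inj; rewrite -/v vE c00 mulmx0 trmx0 //.
Qed.

(** * Prime powers dividing a norm *)

(** The hypothesis expresses characteristic [m], in a form that fits both fields of characteristic
    [p] and the rings ['Z_m]. *)
Lemma intr_eq0_dvd (R : pzRingType) m (z : int) :
  (forall k : nat, (k%:R == 0 :> R) = (m %| k)%N) ->
  (z%:~R == 0 :> R) = (m %| `|z|)%N.
Proof.
move=> h; rewrite {1}[z]intEsign rmorphM rmorph_sign /= -h.
by case: (z < 0); rewrite ?expr0 ?expr1 ?mul1r // mulN1r oppr_eq0.
Qed.

Lemma natr_Zp_eq0 m (k : nat) : (1 < m)%N -> (k%:R == 0 :> 'Z_m) = (m %| k)%N.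
Proof.
move=> m1; apply/eqP/idP => [e | /dvdnP [q ->]].
  by have := val_Zp_nat m1 k; rewrite e /= /dvdn => <-.
by rewrite natrM pchar_Zp // mulr0.
Qed.

Lemma natr_Fp_eq0 p (k : nat) : prime p -> (k%:R == 0 :> 'F_p) = (p %| k)%N.
Proof. by move=> pp; rewrite -(dvdn_pcharf (pchar_Fp pp)). Qed.

Lemma map_ev_int (R : comNzRingType) n (a : 'rV[int]_n.+1) (r : int) :
  (ev a r)%:~R = ev (map_mx intr a) r%:~R :> R.
Proof. exact: map_ev. Qed.

Lemma map_det_opmx (R : comNzRingType) n (G : {poly int}) (a : 'rV[int]_n.+1) :
  (\det (opmx G a))%:~R = \det (opmx (map_poly intr G) (map_mx intr a)) :> R.
Proof. by rewrite -det_map_mx map_opmx. Qed.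

Lemma map_det_unitrow (R : comNzRingType) n (G : {poly int}) (a : 'rV[int]_n.+1) j :
  (\det (unitrow (opmx G a) j))%:~R =
  \det (unitrow (opmx (map_poly intr G) (map_mx intr a)) j) :> R.
Proof. by rewrite -det_map_mx map_unitrow map_opmx. Qed.

Lemma size_map_monic (R : nzRingType) (G : {poly int}) : G \is monic ->
  size (map_poly intr G : {poly R}) = size G.
Proof. by move=> mG; rewrite size_map_poly_id0 // (monicP mG) rmorph1 oner_eq0. Qed.

(* If [p] divided the norm [N] exactly once, the first row of the adjugate, which
   is [p *: y], would give [y *m opmx G a = (N / p) *: e_0] with [N / p] a unit
   modulo [p]; apply both sides to a common null vector. *)
Lemma two_roots_sqr_dvd n (G : {poly int}) (K : fieldType) p (rho : 'I_n.+1 -> K) (a : 'rV[int]_n.+1) i1 i2 :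
  (forall k : nat, (k%:R == 0 :> K) = (p %| k)%N) -> prime p ->
  allroots (map_poly intr G : {poly K}) rho -> i1 != i2 ->
  ev (map_mx intr a) (rho i1) = 0 -> ev (map_mx intr a) (rho i2) = 0 ->
  (p ^ 2 %| `|\det (opmx G a)|)%N.
Proof.
move=> pK pp aG ni e1 e2; have [mG sG inj Grho] := aG.
set M := opmx G a; set N := \det M.
have pdvd z := intr_eq0_dvd z pK.
have pZ z : (p %| `|z|)%N -> exists y : int, z = p%:Z * y.
  by move=> pz; have /dvdzP [y ->] : (p%:Z %| z)%Z by []; exists y; rewrite mulrC.
have [N' NE] : exists y : int, N = p%:Z * y.
  apply: pZ; rewrite -pdvd map_det_opmx (det_opmx _ aG) (bigD1 i1) //= e1 mul0r //.
have [y yE] : exists y : 'rV[int]_n.+1, row 0 (\adj M) = p%:Z *: y.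
  exists (\row_j divz (\adj M 0 j) p%:Z); apply/rowP => j; rewrite [LHS]mxE [RHS]mxE [X in _ * X]mxE.
  have : (p %| `|(\adj M 0 j)%R|)%N.
    by rewrite -det_unitrow -pdvd map_det_unitrow (two_roots_unitrow _ aG ni e1 e2).
  by move=> h; rewrite mulrC divzK.
have p0 : p%:Z != 0 by rewrite eqz_nat -lt0n prime_gt0.
have yM : y *m M = N' *: row 0 1%:M.
  have e : p%:Z *: (y *m M) = p%:Z *: (N' *: row 0 1%:M).
    rewrite scalemxAl -yE -row_mul mul_adj_mx -/N NE scalerA.
    by apply/rowP => i; rewrite !mxE mulr_natr.
  apply/rowP => i; apply: (mulfI p0); have /rowP/(_ i) := e.
  by rewrite [LHS]mxE [RHS]mxE.
suff /pZ [z N'E] : (p %| `|N'|)%N.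
  by rewrite NE N'E mulrA abszM dvdn_mulr // abszM.
have := congr1 (map_mx (intr : int -> K)) yM.
rewrite map_mxM map_mxZ map_opmx => e.
have := congr1 (fun B : 'rV_ _ => B *m powcol n (rho i1)) e.
rewrite -mulmxA opmx_powcol // e1 scale0r mulmx0 -scalemxAl => e'.
rewrite -pdvd; apply/eqP.
have := congr1 (fun B : 'M[K]_1 => B 0 0) e'; rewrite mxE [RHS]mxE map_row map_mx1.
by rewrite -row_mul mul1mx !mxE expr0 mulr1 => <-.
Qed.

(** Modulo [p] some conjugate of [a] vanishes. If only one does, [one_root_unitrow] gives an
    adjugate entry prime to [p], hence a unit modulo [p ^ k], and [adj_root] over ['Z_(p ^ k)]
    produces [r]. *)
Lemma root_dichotomy n (G : {poly int}) (K : fieldType) p k (rho : 'I_n.+1 -> K) (a : 'rV[int]_n.+1) :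
  (forall k : nat, (k%:R == 0 :> K) = (p %| k)%N) -> prime p -> (0 < k)%N ->
  G \is monic -> allroots (map_poly intr G : {poly K}) rho ->
  (p ^ k %| `|\det (opmx G a)|)%N ->
  (exists i1 i2, [/\ i1 != i2, ev (map_mx intr a) (rho i1) = 0 &
     ev (map_mx intr a) (rho i2) = 0]) \/
  (exists r : nat, [/\ (r < p ^ k)%N, (p ^ k %| `|G.[r%:Z]|)%N &
     (p ^ k %| `|ev a r%:Z|)%N]).
Proof.
move=> pK pp k0 mG aG pkN; have [_ sG inj Grho] := aG.
have pdvd z := intr_eq0_dvd z pK.
have : (p %| `|\det (opmx G a)|)%N by apply: dvdn_trans pkN; rewrite dvdn_exp.
rewrite -pdvd map_det_opmx (det_opmx _ aG) => /eqP/eqP/prodf_eq0 [i _ /eqP ei].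
case: (pickP (fun j => (j != i) && (ev (map_mx intr a) (rho j) == 0))).
  by move=> j /andP [ji /eqP ej]; left; exists j, i.
move=> nj; right.
have [|j] := one_root_unitrow aG ei.
  by move=> j ji; have := nj j; rewrite ji /= => ->.
rewrite -map_det_unitrow pdvd => pj.
have m1 : (1 < p ^ k)%N by rewrite -(exp1n k) ltn_exp2r // prime_gt1.
have mK z := @natr_Zp_eq0 (p ^ k) z m1.
have mdvd z := intr_eq0_dvd z mK.
have sG' : size G = n.+2 by move: sG; rewrite size_map_poly_id0 // (monicP mG) oner_eq0.
have [r [Gr ar]] : exists r : 'Z_(p ^ k), (map_poly intr G).[r] = 0 /\
    ev (map_mx intr a) r = 0.
  apply: (@adj_root _ _ _ _ j).
  - exact: monic_map.
  - by rewrite size_map_monic.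
  - by apply/eqP; rewrite -map_det_opmx mdvd.
  - rewrite -map_det_unitrow; set z := \det _ in pj *.
    rewrite [z]intEsign rmorphM rmorph_sign unitrMr ?unitrX ?unitrN1 //.
    by rewrite unitZpE // coprimeXl // prime_coprime.
have rE : r = (r : nat)%:Z%:~R by rewrite -[LHS]natr_Zp.
exists r; split; first by have := ltn_ord r; rewrite [X in (_ < X)%N]Zp_cast.
- by rewrite -mdvd -horner_map /= -rE Gr.
- by rewrite -mdvd map_ev_int -rE ar.
Qed.

(* [D] plays the role of the resultant of [G] and [B]. *)
Definition bezout_irreducible n (G : {poly int}) :=
  forall B : {poly int}, B != 0 -> (size B <= n.+1)%N ->
  exists D : int, D != 0 /\
    forall (K : fieldType) (x : K), (map_poly intr G).[x] = 0 ->
      (map_poly intr B).[x] = 0 -> D%:~R = 0 :> K.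

(** * Passage to a monic polynomial, and separability *)

(** With [c] the leading coefficient of [F], of degree [n + 1], this is the monic [G] such that
    [G(c X) = c^n F(X)]. The top coefficient is set apart because [n - i] truncates to 0 at
    [i = n + 1] and would leave [c] there. *)
Definition monicize n (F : {poly int}) : {poly int} :=
  \poly_(i < n.+2) if i == n.+1 then 1 else lead_coef F ^+ (n - i) * F`_i.

Lemma monicize_size n (F : {poly int}) : size (monicize n F) = n.+2.
Proof. by rewrite size_poly_eq // eqxx oner_eq0. Qed.

Lemma monicize_monic n (F : {poly int}) : monicize n F \is monic.
Proof.
by rewrite monicE lead_coefE monicize_size coef_poly ltnSn eqxx.
Qed.

Lemma monicize_comp n (F : {poly int}) : size F = n.+2 ->
  monicize n F \Po (lead_coef F *: 'X) = lead_coef F ^+ n *: F.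
Proof.
move=> sF; set c := lead_coef F.
rewrite comp_polyE monicize_size -[in RHS](coefK F) sF poly_def scaler_sumr.
apply: eq_bigr => i _; rewrite coef_poly ltn_ord exprZn !scalerA; congr (_ *: _).
case: eqP => [-> | ni].
  by rewrite mul1r -[F`_n.+1](_ : c = _) ?exprSr // /c lead_coefE sF.
rewrite mulrAC -exprD subnK //.
by have := ltn_ord i; move/eqP: ni; lia.
Qed.

Lemma monicize_horner n (F : {poly int}) (x : int) : size F = n.+2 ->
  (monicize n F).[lead_coef F * x] = lead_coef F ^+ n * F.[x].
Proof.
move=> sF; have := congr1 (horner^~ x) (monicize_comp sF).
by rewrite horner_comp !hornerZ hornerX.
Qed.

Lemma monicize_bezout n (F : {poly int}) : size F = n.+2 -> irreducible_poly F ->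
  bezout_irreducible n (monicize n F).
Proof.
move=> sF irrF B B0 sB; set c := lead_coef F.
have c0 : c != 0 by rewrite lead_coef_eq0 -size_poly_eq0 sF.
pose Bc := B \Po (c *: 'X).
have sX : size (c *: 'X : {poly int}) = 2%N by rewrite size_scale // size_polyX.
have sBc : size Bc = size B by rewrite size_comp_poly2.
have cop : coprimep F Bc.
  rewrite irreducible_poly_coprime //; apply/negP => /dvdp_leq.
  by rewrite -size_poly_eq0 sBc size_poly_eq0 => /(_ B0); rewrite sF leqNgt ltnS sB.
have /Bezout_coprimepP [[u v] /=] := cop.
rewrite -size_poly_eq1 => /size_poly1P [D D0 e].
(* [D] is a Bezout constant of [F] and [B(c X)], which would share the root [x / c]. The power of
   [c] settles the fields in which [c] vanishes. *)
exists (D * c ^+ n.+1); split; first by rewrite mulf_neq0 ?expf_neq0.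
move=> K x Gx Bx; have [cK|cK] := eqVneq (c%:~R : K) 0.
  by rewrite rmorphM rmorphXn /= cK exprS mul0r mulr0.
have compE (P : {poly int}) :
    (map_poly intr (P \Po (c *: 'X)) : {poly K}).[x / c%:~R] = (map_poly intr P).[x].
  rewrite map_comp_poly /= horner_comp map_polyZ /= map_polyX hornerZ hornerX.
  by rewrite mulrC divfK.
have := compE (monicize n F); rewrite monicize_comp // Gx map_polyZ hornerZ /= => /eqP.
rewrite mulf_eq0 rmorphXn /= expf_eq0 (negPf cK) andbF /= => /eqP Fx.
have := congr1 (fun P => (map_poly intr P : {poly K}).[x / c%:~R]) e.
rewrite rmorphD !rmorphM /= hornerD !hornerM Fx compE Bx !mulr0 addr0.
by rewrite map_polyC hornerC /= => <-; rewrite mul0r.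
Qed.

(** [D] acts as the discriminant. Ranging over all fields lets one integer serve in characteristic 0
    and in every characteristic [p]. *)
Definition separable_at (G : {poly int}) (D : int) :=
  forall (K : fieldType) (x : K), (map_poly intr G).[x] = 0 ->
      (map_poly intr (deriv G)).[x] = 0 -> D%:~R = 0 :> K.

Lemma bezout_separable n (G : {poly int}) : G \is monic -> size G = n.+2 ->
  bezout_irreducible n G ->
  exists D : int, D != 0 /\ separable_at G D.
Proof.
move=> mG sG; apply.
  apply/eqP => d0; have := congr1 (fun p : {poly int} => p`_n) d0.
  have Gn : G`_n.+1 = 1 by have := monicP mG; rewrite lead_coefE sG.
  by rewrite coef_deriv coef0 Gn => /eqP; rewrite pnatr_eq0.
by rewrite -ltnS -sG lt_size_deriv // -size_poly_eq0 sG.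
Qed.

Lemma closed_allroots (K : closedFieldType) n (G : {poly K}) :
  G \is monic -> size G = n.+2 ->
  (forall x, G.[x] = 0 -> (deriv G).[x] != 0) -> exists rho : 'I_n.+1 -> K, allroots G rho.
Proof.
move=> mG sG sep; have [r] := closed_field_poly_normal G.
rewrite (monicP mG) scale1r => GE.
have sr : size r == n.+1 by rewrite -eqSS -(size_prod_XsubC r id) -GE sG.
have ur : uniq r.
  rewrite -separable_prod_XsubC -GE unlock; apply/Pdiv.ClosedField.coprimepP => x.
  by move/rootP/sep.
exists (fun i => r`_i); split => // [i j|i].
  move/eqP; rewrite nth_uniq ?(eqP sr) //; by move/eqP/val_inj.
by apply/rootP; rewrite GE root_prod_XsubC mem_nth // (eqP sr).
Qed.

Lemma charp_allroots n (G : {poly int}) (D : int) p :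
  G \is monic -> size G = n.+2 ->
  separable_at G D ->
  prime p -> ~~ (p %| `|D|)%N ->
  exists (K : fieldType) (rho : 'I_n.+1 -> K),
    (forall k : nat, (k%:R == 0 :> K) = (p %| k)%N) /\
    allroots (map_poly intr G : {poly K}) rho.
Proof.
move=> mG sG sep pp pD.
have [K [f _]] := countable_algebraic_closure ('F_p).
have pK k : (k%:R == 0 :> K) = (p %| k)%N.
  by rewrite -(rmorph_nat f) fmorph_eq0 natr_Fp_eq0.
have [||x Gx|rho rhoP] := @closed_allroots K n (map_poly intr G).
- exact: monic_map.
- by rewrite size_map_monic.
- rewrite deriv_map; apply/eqP => G'x.
  by have := sep _ _ Gx G'x; move/eqP; rewrite (intr_eq0_dvd _ pK) (negPf pD).
by exists K, rho.
Qed.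

(** * The size of a norm *)

Lemma char0_allroots n (G : {poly int}) : G \is monic -> size G = n.+2 ->
  bezout_irreducible n G ->
  exists rho : 'I_n.+1 -> algC, allroots (map_poly intr G : {poly algC}) rho.
Proof.
move=> mG sG iG; have [D [D0 sep]] := bezout_separable mG sG iG.
apply: closed_allroots.
- exact: monic_map.
- by rewrite size_map_monic.
- move=> x Gx; rewrite deriv_map; apply/eqP => G'x.
  by have /eqP := sep _ _ Gx G'x; rewrite intr_eq0 (negPf D0).
Qed.

(** A vanishing conjugate would be a common root of [G] and of a nonzero polynomial of size at most
    [n.+1], so that a nonzero integer would vanish in [algC]. *)
Lemma opmx_det_neq0 n (G : {poly int}) (a : 'rV[int]_n.+1) : G \is monic ->
  size G = n.+2 -> bezout_irreducible n G -> a != 0 -> \det (opmx G a) != 0.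
Proof.
move=> mG sG iG a0; have [rho aG] := char0_allroots mG sG iG.
rewrite -(intr_eq0 algC) map_det_opmx (det_opmx _ aG); apply/prodf_neq0 => i _.
pose B : {poly int} := \poly_(k < n.+1) a 0 (inord k).
have B0 : B != 0.
  have /rV0Pn [j aj] := a0; apply: contraNneq aj => /(congr1 (fun p : {poly int} => p`_j)).
  by rewrite coef_poly ltn_ord inord_val coef0 => ->.
have [D [D0 h]] := iG B B0 (size_poly _ _).
apply/eqP => e; have [_ _ _ Gr] := aG.
have := h _ _ (Gr i); rewrite (@horner_coef_wide _ n.+1); last first.
  exact: leq_trans (size_poly _ _) (size_poly _ _).
move=> h'; move/eqP: D0; apply; apply/eqP; rewrite -(intr_eq0 algC) h' //.
rewrite -[RHS]e /ev; apply: eq_bigr => k _.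
by rewrite coef_map coef_poly ltn_ord inord_val mxE.
Qed.

(** [C] bounds the sum of the [|rho|^k] for each complex root [rho], so every conjugate is at most
    [C * B]. In the lower bound, [a 0 0] exceeds the contribution of the other coordinates by at
    least [T] in every conjugate. *)
Lemma opmx_det_bounds n (G : {poly int}) : G \is monic ->
  size G = n.+2 -> bezout_irreducible n G ->
  exists C : nat, [/\ (0 < C)%N,
    forall (a : 'rV[int]_n.+1) (B : nat), (forall k, `|(a 0 k)%R| <= B)%N ->
      (`|\det (opmx G a)| <= (C * B) ^ n.+1)%N &
    forall (a : 'rV[int]_n.+1) (B T : nat),
      (forall k : 'I_n.+1, k != 0%R -> `|(a 0 k)%R| <= B)%N -> (C * B + T)%:Z <= a 0 0 ->
      (T ^ n.+1 <= `|\det (opmx G a)|)%N].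
Proof.
move=> mG sG iG; have [rho aG] := char0_allroots mG sG iG.
pose S := \sum_(i < n.+1) \sum_(k < n.+1) `|rho i| ^+ k.
have S0 : 0 <= S by apply: sumr_ge0 => i _; apply: sumr_ge0 => k _; apply: exprn_ge0.
pose C := Num.bound S.
have SC : S <= C%:R by apply/ltW/archi_boundP.
have Si i : \sum_(k < n.+1) `|rho i| ^+ k <= S.
  rewrite /S [leRHS](bigD1 i) //= lerDl; apply: sumr_ge0 => j _.
  by apply: sumr_ge0 => k _; apply: exprn_ge0.
have normE z : (`|z|%N%:R : algC) = `|z%:~R| by rewrite -intr_norm -abszE.
have detE (a : 'rV[int]_n.+1) :
    `|\det (opmx G a)|%N%:R = \prod_i `|ev (map_mx intr a) (rho i)| :> algC.
  by rewrite normE map_det_opmx (det_opmx _ aG) normr_prod.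
have tail (a : 'rV[int]_n.+1) (B : nat) (P : pred 'I_n.+1) i :
    (forall k, P k -> `|(a 0 k)%R| <= B)%N ->
    \sum_(k < n.+1 | P k) `|(a 0 k)%:~R * rho i ^+ k| <= (C * B)%:R.
  move=> aB; apply: (@le_trans _ _ (\sum_(k < n.+1) B%:R * `|rho i| ^+ k)).
    rewrite [leRHS](bigID P) /= -[leLHS]addr0 lerD //.
      apply: ler_sum => k Pk; rewrite normrM normrX ler_wpM2r ?exprn_ge0 //.
      by rewrite -normE ler_nat aB.
    by apply: sumr_ge0 => k _; rewrite mulr_ge0 ?exprn_ge0.
  by rewrite -mulr_sumr mulnC natrM ler_wpM2l // (le_trans (Si i)).
exists C; split.
- rewrite lt0n; apply/eqP => C0; have := SC; rewrite C0 => /(le_trans (Si ord0)).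
  rewrite big_ord_recl expr0 => /(lt_le_trans _) h; suff /h : 0 < 1 + \sum_(i < n) `|rho ord0| ^+ lift ord0 i.
    by rewrite ltxx.
  by rewrite ltr_wpDr ?ltr01 //; apply: sumr_ge0 => k _; apply: exprn_ge0.
- move=> a B aB; rewrite -(ler_nat algC) detE natrX -[X in _ ^+ X]card_ord -prodr_const.
  apply: ler_prod => i _; rewrite normr_ge0 /=.
  apply: le_trans (ler_norm_sum _ _ _) _.
  rewrite (le_trans _ (@tail a B predT i _)) //.
  by apply: ler_sum => k _; rewrite mxE.
- move=> a B T aB a0; rewrite -(ler_nat algC) detE natrX -[X in _ ^+ X]card_ord -prodr_const.
  apply: ler_prod => i _; rewrite ler0n /= /ev (bigD1 0) //= expr0 mulr1 mxE.
  have h := @tail a B (predC1 0) i aB.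
  have a0' : (C * B)%:R + T%:R <= (a 0 0)%:~R :> algC.
    by rewrite -natrD -[(_ + _)%:R]/((_ + _)%N%:Z%:~R) ler_int.
  have a00 : `|(a 0 0)%:~R| = (a 0 0)%:~R :> algC.
    by rewrite ger0_norm // (le_trans _ a0') // -natrD ler0n.
  apply: le_trans (lerB_normD _ _); rewrite a00 lerBrDl.
  apply: le_trans a0'; rewrite lerD2r; apply: le_trans (ler_norm_sum _ _ _) _.
  by apply: le_trans h; apply: ler_sum => k _; rewrite mxE.
Qed.

(** * Points of a box in a residue class *)

Lemma evE (R : comNzRingType) n (a : 'rV[R]_n.+1) x : ev a x = (a *m powcol n x) 0 0.
Proof. by rewrite mxE; apply: eq_bigr => k _; rewrite mxE. Qed.

(** Multiplying [opmx G a *m powcol n x = 0] by the adjugate leaves the determinant in coordinate 0.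
    This is valid over ['Z_m], where [G] need not split. *)
Lemma det_opmx_root (R : comNzRingType) n (G : {poly R}) (a : 'rV[R]_n.+1) x :
  G \is monic -> size G = n.+2 -> G.[x] = 0 -> ev a x = 0 -> \det (opmx G a) = 0.
Proof.
move=> mG sG Gx ax; have := opmx_powcol a mG sG Gx.
rewrite ax scale0r => /(congr1 (fun B => (\adj (opmx G a) *m B) 0 0)).
by rewrite mulmxA mul_adj_mx mulmx0 mul_scalar_mx !mxE expr0 mulr1.
Qed.

Lemma root_dvd_det n (G : {poly int}) (a : 'rV[int]_n.+1) m (r : int) :
  G \is monic -> size G = n.+2 -> (1 < m)%N -> (m %| `|G.[r]|)%N ->
  (m %| `|ev a r|)%N -> (m %| `|\det (opmx G a)|)%N.
Proof.
move=> mG sG m1; have mdvd z := intr_eq0_dvd z (fun k => natr_Zp_eq0 k m1).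
rewrite -!mdvd -horner_map /= map_ev_int map_det_opmx => /eqP Gr /eqP ar.
apply/eqP/(det_opmx_root _ _ Gr ar); first exact: monic_map.
by rewrite size_map_monic.
Qed.

Lemma horner_sub_factor (R : comNzRingType) (Q : {poly R}) (x : R) :
  exists P : {poly R}, Q = P * ('X - x%:P) + Q.[x]%:P.
Proof.
have /factor_theorem [P PE] : root (Q - Q.[x]%:P) x.
  by rewrite /root hornerD hornerN hornerC subrr.
by exists P; rewrite -PE subrK.
Qed.

Lemma dvdz_horner_sub (Q : {poly int}) (x y : int) : (y - x %| Q.[y] - Q.[x])%Z.
Proof.
have [P PE] := horner_sub_factor Q x; rewrite {1}PE.
by rewrite hornerD hornerM hornerXsubC hornerC addrK dvdz_mull.
Qed.

(** [G.[r'] - G.[r]] is [P.[r'] * (r' - r)] with [P.[r']] congruent to [P.[r] = G'(r)] modulo [p],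
    hence prime to [p]. *)
Lemma hensel_unique (G : {poly int}) p k (r r' : int) : prime p ->
  (p ^ k %| `|G.[r]|)%N -> (p ^ k %| `|G.[r']|)%N -> (p %| `|r' - r|)%N ->
  ~~ (p %| `|(deriv G).[r]|)%N -> (p ^ k %| `|r' - r|)%N.
Proof.
move=> pp Gr Gr' prr' pG'.
have [P PE] := horner_sub_factor G r.
have G'r : (deriv G).[r] = P.[r].
  by rewrite PE !poly.derivE mulr1 addr0 hornerD hornerM hornerXsubC subrr mulr0 add0r.
have pk : (p ^ k %| `|(P.[r'] * (r' - r))%R|)%N.
  have -> : P.[r'] * (r' - r) = G.[r'] - G.[r].
    by rewrite {1}PE hornerD hornerM hornerXsubC hornerC addrK.
  suff : ((p ^ k)%N%:Z %| G.[r'] - G.[r])%Z by [].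
  by apply: rpredB.
have pP : ~~ (p %| `|P.[r']|)%N.
  apply: contra pG' => pr; rewrite G'r.
  have h : (p%:Z %| P.[r'] - P.[r])%Z by apply: dvdz_trans (dvdz_horner_sub _ _ _).
  suff : (p%:Z %| P.[r])%Z by [].
  by rewrite -[P.[r]](subKr P.[r']) rpredB.
by rewrite abszM Gauss_dvdr ?coprimeXl ?prime_coprime // in pk.
Qed.

Definition boxvec n X (s : {ffun 'I_n.+1 -> 'I_X}) : 'rV[int]_n.+1 :=
  \row_k (s k : nat)%:Z.

Lemma boxvec_inj n X : injective (@boxvec n X).
Proof.
move=> s t /rowP e; apply/ffunP => k; apply: val_inj.
by have := e k; rewrite !mxE => -[].
Qed.

Lemma card_cubes n X l (A : {set {ffun 'I_n.+1 -> 'I_X}}) : (0 < l)%N ->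
  {in A &, forall s t : {ffun 'I_n.+1 -> 'I_X}, (forall k, (s k %/ l = t k %/ l)%N) -> s = t} ->
  (#|A| <= (X %/ l).+1 ^ n.+1)%N.
Proof.
move=> l0 inj.
have lt (s : {ffun 'I_n.+1 -> 'I_X}) k : (s k %/ l < (X %/ l).+1)%N.
  by rewrite ltnS leq_div2r // ltnW.
pose f (s : {ffun 'I_n.+1 -> 'I_X}) := [ffun k => Ordinal (lt s k)].
rewrite -[X in (_ <= _ ^ X)%N]card_ord -[X in (_ <= X ^ _)%N]card_ord -card_ffun.
rewrite -(card_in_imset (f := f)) ?max_card // => s t sA tA /ffunP e.
by apply: inj => // k; have := e k; rewrite !ffunE => -[].
Qed.

Definition norm_bound n (G : {poly int}) C :=
  (0 < C)%N /\ forall (a : 'rV[int]_n.+1) (B : nat), (forall k, `|(a 0 k)%R| <= B)%N ->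
      (`|\det (opmx G a)| <= (C * B) ^ n.+1)%N.

(* A cube of side [l] contains at most one point of the class as soon as all
   norms of differences inside the cube are smaller than [q]. *)
Lemma card_class n (G : {poly int}) C X q (A : {set {ffun 'I_n.+1 -> 'I_X}}) :
  norm_bound n G C -> (forall a : 'rV[int]_n.+1, a != 0 -> \det (opmx G a) != 0) ->
  (0 < q)%N ->
  {in A &, forall s t : {ffun 'I_n.+1 -> 'I_X}, (q %| `|\det (opmx G (boxvec s - boxvec t))|)%N} ->
  (#|A| * q <= (2 * C) ^ n.+1 * X ^ n.+1 + 2 ^ n.+1 * q)%N.
Proof.
move=> [C0 NC] N0 q0 Aq.
have ex : exists l, (q <= (C * l) ^ n.+1)%N.
  exists q; apply: (@leq_trans q); first by [].
  by rewrite -[leqLHS]expn1 (leq_trans (leq_pexp2l _ (ltn0Sn n))) // leq_exp2r // leq_pmull.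
(* With the least such [l], two points of one cube differ by a vector of norm at most
   [(C * l.-1) ^ n.+1 < q], while [q <= (C * l) ^ n.+1] controls the number of cubes. *)
case: (ex_minnP ex) => l ql lmin.
have l0 : (0 < l)%N.
  by rewrite lt0n; apply: contraTneq ql => ->; rewrite muln0 exp0n // -ltnNge.
have lq : ((C * l.-1) ^ n.+1 < q)%N.
  by rewrite ltnNge; apply/negP => /lmin; rewrite leqNgt ltn_predL l0.
have cA : (#|A| <= (X %/ l).+1 ^ n.+1)%N.
  apply: card_cubes => // s t sA tA e; apply: boxvec_inj; apply/eqP.
  rewrite -subr_eq0; apply: contraLR lq => /N0; rewrite -absz_gt0 -leqNgt => Npos.
  apply: leq_trans (dvdn_leq Npos (Aq _ _ sA tA)) _; apply: NC => k.
  rewrite !mxE; have := divn_eq (s k) l; have := divn_eq (t k) l; rewrite (e k).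
  have := ltn_pmod (s k) l0; have := ltn_pmod (t k) l0.
  move: (t k %/ l * l)%N (s k %% l)%N (t k %% l)%N (nat_of_ord (s k)) (nat_of_ord (t k)).
  by move=> v x y u w; lia.
have h : ((X %/ l).+1 ^ n.+1 <= 2 ^ n.+1 * (X %/ l) ^ n.+1 + 2 ^ n.+1)%N.
  rewrite -expnMn; case: (X %/ l)%N => [|y]; first by rewrite exp1n addn_gt0 !expn_gt0 orbT.
  by rewrite (leq_trans _ (leq_addr _ _)) // leq_exp2r //; lia.
apply: leq_trans (leq_mul cA (leqnn q)) _.
apply: leq_trans (leq_mul h (leqnn q)) _; rewrite mulnDl leq_add2r.
rewrite expnMn -!mulnA leq_mul2l expn_eq0 /= (leq_trans (leq_mul (leqnn _) ql)) //.
by rewrite -!expnMn leq_exp2r // mulnCA leq_mul2l leq_divM orbT.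
Qed.

Lemma card_bigcup_leq (T I : finType) (A : I -> {set T}) :
  (#|\bigcup_i A i| <= \sum_i #|A i|)%N.
Proof.
elim/big_ind2: _ => // [|m A1 k A2 h1 h2]; first by rewrite cards0.
by apply: leq_trans (leq_card_setU _ _) _; apply: leq_add.
Qed.

Lemma dvdn_dist_small m (x y : nat) :
  (x < m)%N -> (y < m)%N -> (m %| `|x%:Z - y%:Z|)%N -> x = y.
Proof.
move=> xm ym d; have [//|nxy] := eqVneq x y.
have : (0 < `|x%:Z - y%:Z|)%N by clear -nxy; lia.
by move/dvdn_leq/(_ d); clear -xm ym; lia.
Qed.

Definition boxelt n X W (o : 'rV[int]_n.+1) (s : {ffun 'I_n.+1 -> 'I_X}) :=
  o + W%:Z *: boxvec s.

Lemma boxeltB n X W (o : 'rV[int]_n.+1) (s t : {ffun 'I_n.+1 -> 'I_X}) :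
  boxelt W o s - boxelt W o t = W%:Z *: (boxvec s - boxvec t).
Proof. by rewrite /boxelt opprD addrACA subrr add0r scalerBr. Qed.

Lemma allroots_root (L : fieldType) n (G : {poly L}) (rho : 'I_n.+1 -> L) x :
  allroots G rho -> G.[x] = 0 -> exists i, x = rho i.
Proof.
move=> [mG sG inj Grho] Gx.
have [/codomP [i ->]|nx] := boolP (x \in codom rho); first by exists i.
have : (size (x :: codom rho) < size G)%N.
  apply: max_poly_roots; first exact: monic_neq0.
    rewrite /= /root Gx eqxx; apply/allP => y /codomP [i ->].
    by rewrite /root Grho.
  by rewrite /= nx map_inj_uniq ?enum_uniq.
by rewrite /= size_codom card_ord sG ltnn.
Qed.

(** [root_dichotomy] at level [p ^ 2] sorts these points into classes, one for each pair of roots in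
    characteristic [p] and one for each root. Within a class the norms of differences are divisible
    by [p ^ 2]: by [two_roots_sqr_dvd] for a pair, and for a single root because [hensel_unique]
    makes all points of the class share the same [r] modulo [p ^ 2]. *)
Lemma card_bad n (G : {poly int}) (D : int) C X p W (o : 'rV[int]_n.+1) :
  G \is monic -> size G = n.+2 -> separable_at G D ->
  norm_bound n G C -> (forall a : 'rV[int]_n.+1, a != 0 -> \det (opmx G a) != 0) ->
  prime p -> ~~ (p %| `|D|)%N -> ~~ (p %| W)%N ->
  (#|[set s : {ffun 'I_n.+1 -> 'I_X} | (p ^ 2 %| `|\det (opmx G (boxelt W o s))|)%N]|
     * p ^ 2 <=
   (n.+1 ^ 2 + n.+1) * ((2 * C) ^ n.+1 * X ^ n.+1 + 2 ^ n.+1 * p ^ 2))%N.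
Proof.
move=> mG sG sep NC N0 pp pD pW.
have [K [rho [pK aG]]] := charp_allroots mG sG sep pp pD.
have pdvd z := intr_eq0_dvd z pK; have [_ _ inj Grho] := aG.
have p2 : (0 < p ^ 2)%N by rewrite expn_gt0 prime_gt0.
pose evK (s : {ffun 'I_n.+1 -> 'I_X}) := ev (map_mx (intr : int -> K) (boxelt W o s)).
pose A1 (ij : 'I_n.+1 * 'I_n.+1) := [set s : {ffun 'I_n.+1 -> 'I_X} |
  [&& ij.1 != ij.2, evK s (rho ij.1) == 0 & evK s (rho ij.2) == 0]].
pose A2 (i : 'I_n.+1) := [set s : {ffun 'I_n.+1 -> 'I_X} | [exists r : 'I_(p ^ 2),
  [&& (p ^ 2 %| `|G.[(r : nat)%:Z]|)%N,
      (p ^ 2 %| `|ev (boxelt W o s) (r : nat)%:Z|)%N & (r : nat)%:R == rho i]]].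
set A := [set _ | _].
have sub : A \subset (\bigcup_ij A1 ij) :|: (\bigcup_i A2 i).
  apply/fintype.subsetP => s; rewrite inE => /(@root_dichotomy _ _ _ _ 2 _ _ pK pp isT mG aG).
  case=> [[i1 [i2 [ni e1 e2]]] | [r [rp Gr ar]]]; rewrite inE; apply/orP; [left|right].
    by apply/bigcupP; exists (i1, i2) => //; rewrite inE /= ni /evK e1 e2 eqxx.
  have Gr0 : (map_poly intr G : {poly K}).[r%:R] = 0.
    apply/eqP; rewrite -[r%:R]/(r%:Z%:~R) horner_map /= pdvd.
    by apply: dvdn_trans Gr; rewrite dvdn_exp.
  have [i ri] := allroots_root aG Gr0.
  apply/bigcupP; exists i => //; rewrite inE; apply/existsP; exists (Ordinal rp).
  by rewrite /= Gr ar ri eqxx.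
have c1 ij : (#|A1 ij| * p ^ 2 <= (2 * C) ^ n.+1 * X ^ n.+1 + 2 ^ n.+1 * p ^ 2)%N.
  apply: (card_class NC N0) => // s t; rewrite !inE => /and3P [ni /eqP s1 /eqP s2].
  move=> /and3P [_ /eqP t1 /eqP t2].
  have h i : evK s (rho i) = 0 -> evK t (rho i) = 0 ->
      ev (map_mx intr (boxvec s - boxvec t)) (rho i) = 0.
    move=> es et; have : evK s (rho i) - evK t (rho i) = 0 by rewrite es et subr0.
    rewrite -evB -map_mxB boxeltB map_mxZ evZ => /eqP.
    by rewrite mulf_eq0 pdvd (negPf pW) => /eqP.
  exact: (two_roots_sqr_dvd pK pp aG ni (h _ s1 t1) (h _ s2 t2)).
have c2 i : (#|A2 i| * p ^ 2 <= (2 * C) ^ n.+1 * X ^ n.+1 + 2 ^ n.+1 * p ^ 2)%N.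
  apply: (card_class NC N0) => // s t; rewrite !inE.
  move=> /existsP [r /and3P [Gr sr ri]] /existsP [r' /and3P [Gr' tr' ri']].
  have rr' : r' = r.
    apply: val_inj; rewrite /=.
    have : (p ^ 2 %| `|(r' : nat)%:Z - (r : nat)%:Z|)%N.
      apply: (hensel_unique pp Gr Gr').
        by rewrite -pdvd rmorphB /= -!pmulrn (eqP ri) (eqP ri') subrr.
      rewrite -pdvd -horner_map /= -pmulrn (eqP ri); apply: contraNN pD => /eqP G'.
      by rewrite -pdvd; apply/eqP/(sep _ _ (Grho i) G').
    exact: dvdn_dist_small.
  apply: (@root_dvd_det _ _ _ _ (r : nat)%:Z mG sG) => //.
    by rewrite (leq_trans (prime_gt1 pp)) // leq_pmulr ?prime_gt0.
  have : ((p ^ 2)%N%:Z %| ev (boxelt W o s) (r : nat)%:Z - ev (boxelt W o t) (r : nat)%:Z)%Z.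
    by apply: rpredB => //; rewrite -rr'.
  rewrite -evB boxeltB evZ Gauss_dvdzr // /coprimez /gcdz /= eqz_nat.
  by rewrite -/(coprime _ _) coprimeXl // prime_coprime.
apply: leq_trans (leq_mul (subset_leq_card sub) (leqnn _)) _.
apply: leq_trans (leq_mul (leq_card_setU _ _) (leqnn _)) _; rewrite !mulnDl leq_add //.
  apply: leq_trans (leq_mul (card_bigcup_leq _) (leqnn _)) _; rewrite big_distrl /=.
  rewrite (leq_trans (leq_sum _ (fun ij _ => c1 ij))) //.
  by rewrite sum_nat_const card_prod card_ord.
apply: leq_trans (leq_mul (card_bigcup_leq _) (leqnn _)) _; rewrite big_distrl /=.
rewrite (leq_trans (leq_sum _ (fun i _ => c2 i))) //.
by rewrite sum_nat_const card_ord.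
Qed.

Lemma good_root n (G : {poly int}) (D : int) p (a : 'rV[int]_n.+1) :
  G \is monic -> size G = n.+2 -> separable_at G D ->
  prime p -> ~~ (p %| `|D|)%N ->
  (p %| `|\det (opmx G a)|)%N -> ~~ (p ^ 2 %| `|\det (opmx G a)|)%N ->
  exists r : nat, [/\ (r < p)%N, (p %| `|G.[r%:Z]|)%N & (p %| `|ev a r%:Z|)%N].
Proof.
move=> mG sG sep pp pD pN npN.
have [K [rho [pK aG]]] := charp_allroots mG sG sep pp pD.
have [] := @root_dichotomy _ _ _ _ 1 _ a pK pp isT mG aG; first by rewrite expn1.
  by move=> [i1 [i2 [ni e1 e2]]]; rewrite (two_roots_sqr_dvd pK pp aG ni e1 e2) in npN.
by rewrite expn1.
Qed.

Lemma opmx_entry_bound n (G : {poly int}) : exists C : nat,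
  forall (b : 'rV[int]_n.+1) (L : nat), (forall k, `|(b 0 k)%R| <= L)%N ->
  forall i j, (`|(opmx G b i j)%R| <= C * L)%N.
Proof.
exists (\sum_(k < n.+1) \sum_i \sum_j `|((companion n G ^+ k) i j)%R|)%N => b L bL i j.
rewrite -lez_nat abszE /opmx summxE; apply: le_trans (ler_norm_sum _ _ _) _.
rewrite big_distrl /= rmorph_sum; apply: ler_sum => k _.
rewrite mxE normrM -!abszE -PoszM lez_nat mulnC leq_mul //.
rewrite (bigD1 i) //= (leq_trans _ (leq_addr _ _)) //.
by rewrite (bigD1 j) //= leq_addr.
Qed.

(* Reduction of [c e_0] modulo the ideal generated by a short element [b]. *)
Lemma small_representatives n (G : {poly int}) : G \is monic -> size G = n.+2 ->
  (forall a : 'rV[int]_n.+1, a != 0 -> \det (opmx G a) != 0) ->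
  exists C : nat, forall (m L : nat) (r : int), (0 < m < L ^ n.+1)%N ->
    (m %| `|G.[r]|)%N -> forall c : nat, exists t : 'rV[int]_n.+1,
      (forall k, `|(t 0 k)%R| <= C * L)%N /\ (m%:Z %| ev t r - c%:Z)%Z.
Proof.
move=> mG sG N0; have [C1 C1P] := opmx_entry_bound n G.
exists (n.+1 * C1)%N => m L r /andP [m0 mL] Gr c.
(* Pigeonhole: the box of side [L] has [L ^ n.+1 > m] points, and evaluation at [r] takes at most
   [m] values modulo [m]. *)
have [b [bn0 bL br]] : exists b : 'rV[int]_n.+1,
    [/\ b != 0, forall k, (`|(b 0 k)%R| <= L)%N & (m%:Z %| ev b r)%Z].
  pose res (s : {ffun 'I_n.+1 -> 'I_L}) := `|(ev (boxvec s) r %% m%:Z)%Z|%N.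
  have resm s : (res s < m)%N.
    by rewrite -ltz_nat /res gez0_abs ?modz_ge0 ?ltz_pmod // eqz_nat -lt0n.
  pose f s := Ordinal (resm s).
  have : ~~ injectiveb f.
    apply/injectiveP => /leq_card; rewrite card_ffun !card_ord => h.
    by have := leq_trans mL h; rewrite ltnn.
  case/injectivePn => s [t nst [fst]]; exists (boxvec s - boxvec t); split.
  - by rewrite subr_eq0; apply: contraNneq nst => /boxvec_inj ->.
  - move=> k; rewrite !mxE; have := ltn_ord (s k); have := ltn_ord (t k).
    by move: (nat_of_ord (s k)) (nat_of_ord (t k)) => x y; clear; lia.
  - rewrite evB -eqz_mod_dvd -[X in X == _]gez0_abs ?modz_ge0 ?eqz_nat -?lt0n //.
    by rewrite -[X in _ == X]gez0_abs ?modz_ge0 ?eqz_nat -?lt0n // -/(res s) fst.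
pose M := opmx G b; pose N := \det M; have Nn0 : N != 0 by apply: N0.
pose v : 'rV[int]_n.+1 := c%:Z *: delta_mx 0 0.
pose w := v *m \adj M.
pose z : 'rV[int]_n.+1 := \row_k divz (w 0 k) N.
pose e : 'rV[int]_n.+1 := \row_k modz (w 0 k) N.
have wE : w = N *: z + e.
  by apply/rowP => k; rewrite [RHS]mxE [X in X + _]mxE !mxE mulrC -divz_eq.
(* The coordinates of [v] in the basis of rows of [M] are [w / N]. Subtracting integer parts leaves
   [e / N], with entries below 1 in absolute value, so the remainder is as short as the rows of [M]
   up to a constant. *)
have tE : N *: (v - z *m M) = e *m M.
  rewrite scalerBr scalemxAl -[N *: z](addrK e) -wE mulmxBl -mulmxA mul_adj_mx.
  by rewrite mul_mx_scalar opprB addrCA subrr addr0.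
exists (v - z *m M); split.
  move=> k; have N0' : (0 < `|N|)%N by rewrite absz_gt0.
  rewrite -(leq_pmul2l N0') -abszM.
  have -> : N * (v - z *m M) 0 k = (e *m M) 0 k by rewrite -tE [RHS]mxE.
  rewrite mxE -lez_nat abszE; apply: le_trans (ler_norm_sum _ _ _) _.
  apply: (@le_trans _ _ (\sum_(j < n.+1) (`|N| * (C1 * L))%N%:Z)).
    apply: ler_sum => j _; rewrite normrM -!abszE -PoszM lez_nat leq_mul ?C1P //.
    by rewrite mxE -lez_nat gez0_abs ?modz_ge0 // ltW // abszE ltz_mod.
  rewrite sumr_const card_ord -mulr_natr natz -PoszM lez_nat.
  by rewrite mulnC mulnCA !mulnA.
have zM : (m%:Z %| ev (z *m M) r)%Z.
  have [m1|m1] := leqP m 1.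
    by rewrite (_ : m = 1%N) ?dvd1z //; apply/eqP; rewrite eqn_leq m1 m0.
  have mdvd y := intr_eq0_dvd y (fun k => natr_Zp_eq0 k m1).
  suff : (m %| `|ev (z *m M) r|)%N by [].
  rewrite -mdvd map_ev_int evE map_mxM map_opmx -mulmxA opmx_powcol.
  - by move: br; rewrite -[(_ %| _)%Z]/(m %| `|_|)%N -mdvd map_ev_int => /eqP ->;
      rewrite scale0r mulmx0 mxE.
  - exact: monic_map.
  - by rewrite size_map_monic.
  - by apply/eqP; rewrite -[r%:~R]/(intr r) horner_map /= mdvd.
rewrite evB addrAC rpredB // evZ (_ : ev _ r = 1) ?mulr1 ?subrr ?dvdz0 //.
rewrite /ev (bigD1 0) //= big1 => [|k /negPf k0]; first by rewrite mxE !eqxx expr0 mulr1 addr0.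
by rewrite mxE k0 andbF mul0r.
Qed.

(* The translates of the class by a system of small representatives modulo [m]
   are disjoint. *)
Lemma card_root_class n (G : {poly int}) : G \is monic -> size G = n.+2 ->
  (forall a : 'rV[int]_n.+1, a != 0 -> \det (opmx G a) != 0) ->
  exists C : nat, forall (m L X W : nat) (o : 'rV[int]_n.+1) (r : int),
    (0 < m < L ^ n.+1)%N -> coprime m W -> (m %| `|G.[r]|)%N ->
    (#|[set s : {ffun 'I_n.+1 -> 'I_X} | (m %| `|ev (boxelt W o s) r|)%N]| * m
       <= (X + C * L) ^ n.+1)%N.
Proof.
move=> mG sG N0; have [C CP] := small_representatives mG sG N0.
exists (2 * C)%N => m L X W o r mL cW Gr.
have m0 : (0 < m)%N by case/andP: mL.
have L0 : (0 < L)%N.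
  by rewrite lt0n; apply: contraTneq mL => ->; rewrite exp0n // ltn0 andbF.
have [t tP] := fin_all_exists (fun c : 'I_m => CP m L r mL Gr c).
set A := [set _ | _]; set H := (C * L)%N.
(* The shift by [H] makes the translated coordinates nonnegative, and they then stay below
   [X + 2 * H]. *)
have lt (u : {ffun 'I_n.+1 -> 'I_X} * 'I_m) k :
    (`|((u.1 k : nat)%:Z + t u.2 0 k + H%:Z)%R| < X + 2 * C * L)%N.
  have := (tP u.2).1 k; have := ltn_ord (u.1 k).
  rewrite -mulnA -/H; move: (nat_of_ord (u.1 k)) (t u.2 0 k) => x y; clear; lia.
pose f u := [ffun k => Ordinal (lt u k)].
rewrite -[X in (_ * X)%N]card_ord -cardsT -cardsX.
rewrite -[X in (_ <= _ ^ X)%N]card_ord -[X in (_ <= X ^ _)%N]card_ord -card_ffun.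
rewrite -(card_in_imset (f := f)) ?max_card //.
move=> [s c] [s' c']; rewrite !inE /= !andbT => sA s'A /ffunP fE.
have e : boxvec s - boxvec s' = t c' - t c.
  apply/rowP => k; rewrite !mxE; have := fE k; rewrite !ffunE => /(congr1 val) /=.
  have := (tP c).1 k; have := (tP c').1 k.
  move: (t c 0 k) (t c' 0 k) (nat_of_ord (s k)) (nat_of_ord (s' k)) => y y' x x'.
  rewrite -/H; clear; lia.
have : (m%:Z %| ev (boxelt W o s) r - ev (boxelt W o s') r)%Z by apply: rpredB.
rewrite -evB boxeltB evZ Gauss_dvdzr; last by rewrite /coprimez /gcdz /= eqz_nat.
rewrite e evB => h.
have cc : c = c'.
  apply: val_inj; apply: (@dvdn_dist_small m); rewrite ?ltn_ord //.
  suff : (m%:Z %| (c : nat)%:Z - (c' : nat)%:Z)%Z by [].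
  have -> : (c : nat)%:Z - (c' : nat)%:Z = (ev (t c') r - (c' : nat)%:Z) -
    (ev (t c) r - (c : nat)%:Z) - (ev (t c') r - ev (t c) r) by ring.
  by apply: rpredB => //; apply: rpredB; [have [] := tP c' | have [] := tP c].
rewrite -cc subrr in e; rewrite -cc; congr (_, _).
by apply/boxvec_inj/eqP; rewrite -subr_eq0 e.
Qed.

(** * Logarithms and elementary prime estimates *)

Lemma ln_natX (R : realType) (a k : nat) : (0 < a)%N ->
  ln (a ^ k)%:R = k%:R * ln a%:R :> R.
Proof. by move=> a0; rewrite natrX lnXn ?ltr0n // mulr_natl. Qed.

Lemma ln_nat_ge0 (R : realType) (a : nat) : 0 <= ln a%:R :> R.
Proof.
by case: a => [|a]; [rewrite ln0 | rewrite ln_ge0 // ler1n].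
Qed.

(** The case [a = 0] rests on the default value [ln 0 = 0]. *)
Lemma ler_ln_nat (R : realType) (a b : nat) : (a <= b)%N -> ln a%:R <= ln b%:R :> R.
Proof.
case: a => [|a] ab; first by rewrite ln0 // ln_nat_ge0.
by rewrite ler_ln ?posrE ?ltr0n ?(leq_trans _ ab) // ler_nat.
Qed.

Lemma ln_natM (R : realType) (a b : nat) : (0 < a)%N -> (0 < b)%N ->
  ln (a * b)%:R = ln a%:R + ln b%:R :> R.
Proof. by move=> a0 b0; rewrite natrM lnM ?posrE ?ltr0n. Qed.

Lemma ln_prod_nat (R : realType) (I : Type) (s : seq I) (P : pred I) (F : I -> nat) :
  (forall i, P i -> (0 < F i)%N) ->
  ln (\prod_(i <- s | P i) F i)%:R = \sum_(i <- s | P i) ln (F i)%:R :> R.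
Proof.
move=> F0; elim: s => [|i s IH]; first by rewrite !big_nil ln1.
rewrite !big_cons; case: ifP => // Pi.
by rewrite ln_natM ?IH ?F0 // prodn_cond_gt0.
Qed.

Lemma ln_primes (R : realType) (N : nat) : (0 < N)%N ->
  ln N%:R = \sum_(p <- primes N) (logn p N)%:R * ln p%:R :> R.
Proof.
move=> N0; rewrite {1}(prod_prime_decomp N0) prime_decompE big_map big_seq.
rewrite ln_prod_nat => [|p]; last by rewrite mem_primes expn_gt0 => /andP [/prime_gt0 ->].
rewrite [RHS]big_seq; apply: eq_bigr => p; rewrite mem_primes => /andP [/prime_gt0 p0 _].
by rewrite ln_natX.
Qed.

Lemma sum_primes_range (R : realType) (N M : nat) (F : nat -> R) : (0 < N)%N -> (N <= M)%N ->
  \sum_(p <- primes N) F p = \sum_(0 <= p < M.+1 | prime p && (p %| N)%N) F p.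
Proof.
move=> N0 NM; rewrite -[RHS]big_filter; apply: perm_big; apply: uniq_perm.
- exact: primes_uniq.
- by rewrite filter_uniq ?iota_uniq.
- move=> p; rewrite mem_primes mem_filter mem_index_iota N0 /= ltnS.
  by case: (prime p) => //=; case d: (p %| N)%N => //=; rewrite (leq_trans (dvdn_leq N0 d)).
Qed.

Lemma ln_squarefree (R : realType) (N M : nat) : (0 < N)%N -> (N <= M)%N ->
  (forall p, prime p -> ~~ (p ^ 2 %| N)%N) ->
  ln N%:R = \sum_(0 <= p < M.+1 | prime p && (p %| N)%N) ln p%:R :> R.
Proof.
move=> N0 NM sf; rewrite -sum_primes_range // ln_primes //.
apply: eq_big_seq => p; rewrite mem_primes => /and3P [pp _ pN].
suff -> : logn p N = 1%N by rewrite mul1r.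
have := sf p pp; rewrite pfactor_dvdn // -ltnNge.
by have : (0 < logn p N)%N by [rewrite logn_gt0 mem_primes pp N0 pN]; lia.
Qed.

Lemma sum_ln_dvd_le (R : realType) (N M : nat) (P : pred nat) : (0 < N)%N ->
  \sum_(0 <= p < M.+1 | [&& prime p, P p & (p %| N)%N]) ln p%:R <= ln N%:R :> R.
Proof.
move=> N0; pose M' := maxn M N.
apply: (@le_trans _ _ (\sum_(0 <= p < M'.+1 | prime p && (p %| N)%N) ln p%:R)).
  rewrite [leRHS](big_cat_nat (n := M.+1)) ?ltnS ?leq_maxl //=.
  rewrite -[leLHS]addr0 lerD ?sumr_ge0 // => [|p _]; last exact: ln_nat_ge0.
  rewrite [leRHS](bigID P) /= -[leLHS]addr0 lerD ?sumr_ge0 // => [|p _]; last exact: ln_nat_ge0.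
  rewrite le_eqVlt; apply/orP; left; apply/eqP/eq_bigl => p.
  by rewrite -andbA [P p && _]andbC.
rewrite -sum_primes_range ?leq_maxr // ln_primes // big_seq [leRHS]big_seq.
apply: ler_sum => p; rewrite mem_primes => /and3P [pp _ pN].
by rewrite ler_peMl ?ln_nat_ge0 // ler1n logn_gt0 mem_primes pp N0 pN.
Qed.

Lemma prod_primes_dvd (s : seq nat) (N : nat) : uniq s ->
  (forall p, p \in s -> prime p -> (p %| N)%N) -> (\prod_(p <- s | prime p) p %| N)%N.
Proof.
elim: s N => [|p s IH] N /=; first by rewrite big_nil dvd1n.
case/andP => ps us h; rewrite big_cons; case: ifP => [pp|_]; last first.
  by apply: IH => // q qs; apply: h; rewrite inE qs orbT.
rewrite Gauss_dvd.
  rewrite h ?inE ?eqxx //=; apply: IH => // q qs; apply: h; by rewrite inE qs orbT.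
rewrite coprime_sym big_seq_cond.
apply: (big_ind (fun x => coprime x p)); rewrite ?coprime1n //.
  by move=> x y; rewrite coprimeMl => -> ->.
move=> q /andP [qs qp]; rewrite prime_coprime // dvdn_prime2 //.
by apply: contraNneq ps => <-.
Qed.

(** The two equal middle coefficients both occur in the expansion of [(1 + 1) ^ m.*2.+1]. *)
Lemma binom_odd_le m : ('C(m.*2.+1, m) <= 4 ^ m)%N.
Proof.
have : (2 * 'C(m.*2.+1, m) <= 2 ^ m.*2.+1)%N.
  rewrite -[X in (_ <= X ^ _)%N]/(1 + 1)%N expnDn.
  have lm : (m < m.*2.+2)%N by rewrite -addnn; lia.
  have lm1 : (m.+1 < m.*2.+2)%N by rewrite -addnn; lia.
  rewrite (bigD1 (Ordinal lm)) //= (bigD1 (Ordinal lm1)) //=; last first.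
    by apply/eqP => /(congr1 val) /=; lia.
  rewrite !exp1n !muln1 addnA (leq_trans _ (leq_addr _ _)) //.
  have -> : 'C(m.*2.+1, m.+1) = 'C(m.*2.+1, m).
    by rewrite -bin_sub; [congr binomial|]; rewrite -addnn; lia.
  by rewrite mul2n addnn.
by rewrite expnS leq_mul2l /= -muln2 mulnC expnM.
Qed.

Lemma prime_dvd_fact_leq p k : prime p -> (p %| k`!)%N -> (p <= k)%N.
Proof.
move=> pp; elim: k => [|k IH]; first by rewrite dvdn1 => /eqP p1; rewrite p1 in pp.
by rewrite factS Euclid_dvdM // => /orP [/dvdn_leq -> //|/IH /leqW].
Qed.

(** Induction after Erdos: for [n = 2m + 1] the primes in [(m + 1, n]] all divide ['C(n, m)], which
    is at most [4 ^ m]; an even [n > 2] adds no factor. *)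
Lemma primorial_le n : (\prod_(0 <= p < n.+1 | prime p) p <= 4 ^ n)%N.
Proof.
have [k] := ubnP n; elim: k n => // k IH n nk.
have [n2|n2] := leqP n 2.
  by case: n n2 {nk} => [|[|[|]]] // _; rewrite unlock.
have [on|en] := boolP (odd n); last first.
  have np : ~~ prime n.
    apply: contra en => pn; case: (even_prime pn) => // e.
    by rewrite e ltnn in n2.
  rewrite big_mkcond big_nat_recr //= (negPf np) muln1 -big_mkcond /=.
  have n1 : n = n.-1.+1 by rewrite prednK // (leq_trans _ n2).
  by rewrite {1}n1 (leq_trans (IH n.-1 _)) ?leq_exp2l ?leq_pred //; clear -nk n2; lia.
pose m := n./2; have nE : n = m.*2.+1 by rewrite -[LHS]odd_double_half on.
have mn : (m.+2 <= n.+1)%N by rewrite nE -addnn; lia.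
rewrite (big_cat_nat (n := m.+2)) //=.
rewrite (@leq_trans (4 ^ m.+1 * 4 ^ m)) //; last first.
  by rewrite -expnD leq_exp2l // nE -addnn; lia.
rewrite leq_mul ?IH //; first by move: n2 nk; rewrite nE -addnn; lia.
apply: leq_trans (binom_odd_le m); apply: dvdn_leq.
  by rewrite bin_gt0 -addnn; lia.
apply: prod_primes_dvd => [|p]; first exact: iota_uniq.
rewrite mem_index_iota => /andP [mp pn] pp.
have lm : (m <= m.*2.+1)%N by rewrite -addnn; lia.
have : (p %| 'C(m.*2.+1, m) * (m`! * (m.*2.+1 - m)`!))%N.
  by rewrite bin_fact // dvdn_fact // -nE prime_gt0.
by rewrite !Euclid_dvdM // => /or3P [] // /(prime_dvd_fact_leq pp); move: mp; rewrite -addnn; lia.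
Qed.

Lemma chebyshev_theta_le (R : realType) (n : nat) :
  \sum_(0 <= p < n.+1 | prime p) ln p%:R <= n%:R * ln 4 :> R.
Proof.
rewrite -ln_prod_nat => [|p /prime_gt0 //].
by rewrite -ln_natX // ler_ln_nat // primorial_le.
Qed.

(** Telescoping, as [1 / p^2] is less than [1 / (p - 1) - 1 / p]. *)
Lemma sum_inv_sqr_le (R : realType) (K M : nat) : (0 < K)%N ->
  \sum_(K.+1 <= p < M) (p%:R ^+ 2)^-1 <= K%:R^-1 :> R.
Proof.
move=> K0; have [MK|KM] := leqP M K.+1; first by rewrite big_geq ?invr_ge0.
suff : \sum_(K.+1 <= p < M) (p%:R ^+ 2)^-1 <= K%:R^-1 - (M.-1)%:R^-1 :> R.
  by move/le_trans; apply; rewrite gerBl invr_ge0.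
move/ltnW: KM; elim: M => // M IH; rewrite leq_eqVlt => /predU1P [<-|KM].
  by rewrite big_geq // subrr.
rewrite big_nat_recr //=; apply: le_trans (lerD (IH KM) (lexx _)) _.
rewrite -addrA lerD2l; case: M KM {IH} => // M /=; rewrite ltnS => KM.
have M0 : (0 : R) < M%:R by rewrite ltr0n (leq_trans K0).
rewrite -[M.+1]addn1 natrD -subr_ge0.
have -> : - (M%:R + 1)^-1 - (- M%:R^-1 + ((M%:R + 1) ^+ 2)^-1) =
   (M%:R * (M%:R + 1) ^+ 2)^-1 :> R by field; lra.
by rewrite invr_ge0 mulr_ge0 ?sqr_ge0 // ltW.
Qed.

(** * Roots modulo [p], and norms in the shifted box *)

Definition nroots (G : {poly int}) p : nat :=
  #|[set r : 'I_p | (p %| `|G.[(r : nat)%:Z]|)%N]|.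

Lemma nroots_Fp (G : {poly int}) p : prime p ->
  nroots G p = #|[set x : 'F_p | (map_poly intr G).[x] == 0]|.
Proof.
move=> pp; pose f (r : 'I_p) : 'F_p := (r : nat)%:R.
have mdvd k := @natr_Fp_eq0 p k pp.
have injf : injective f.
  move=> r r' e; apply/val_inj/(@dvdn_dist_small p); rewrite ?ltn_ord //.
  by rewrite -(intr_eq0_dvd _ mdvd) rmorphB /= -!pmulrn -/(f r) -/(f r') e subrr.
have fE r : (map_poly intr G).[f r] = G.[(r : nat)%:Z]%:~R.
  by rewrite -[f r]/((r : nat)%:Z%:~R) horner_map.
rewrite /nroots -(card_imset _ injf); apply: eq_card => x; rewrite [RHS]inE.
apply/imsetP/eqP => [[r] | Gx].
  by rewrite inE -(intr_eq0_dvd _ mdvd) -fE => /eqP Gr ->.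
have xp : (x < p)%N by have := ltn_ord x; rewrite [X in (_ < X)%N]Fp_cast.
have xE : x = f (Ordinal xp) by rewrite /f /= natr_Zp.
by exists (Ordinal xp); rewrite // inE -(intr_eq0_dvd _ mdvd) -fE -xE Gx.
Qed.

Lemma nroots_le n (G : {poly int}) p : G \is monic -> size G = n.+2 -> prime p ->
  (nroots G p <= n.+1)%N.
Proof.
move=> mG sG pp; rewrite nroots_Fp // cardE -ltnS -sG -(size_map_monic 'F_p mG).
apply: max_poly_roots; rewrite ?enum_uniq //.
  by apply: monic_neq0; apply: monic_map.
by apply/allP => x; rewrite mem_enum inE.
Qed.

Definition norm_lower n (G : {poly int}) C :=
  forall (a : 'rV[int]_n.+1) (B T : nat),
      (forall k : 'I_n.+1, k != 0%R -> `|(a 0 k)%R| <= B)%N ->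
      (C * B + T)%:Z <= a 0 0 -> (T ^ n.+1 <= `|\det (opmx G a)|)%N.

(* The shift makes [a_0] dominate the other coordinates, so that the norm is at
   least [X^(n+1)], and it keeps the norm congruent to 1 modulo [W]. *)
Definition center n C W X : 'rV[int]_n.+1 := (1 + W * (C.+1 * X))%N%:Z *: delta_mx 0 0.

Lemma boxelt_center0 n C W X (s : {ffun 'I_n.+1 -> 'I_X}) :
  boxelt W (center n C W X) s 0 0 = (1 + W * (C.+1 * X) + W * s 0%R)%N%:Z.
Proof. by rewrite !mxE !eqxx mulr1 !PoszD !PoszM. Qed.

Lemma boxelt_centerS n C W X (s : {ffun 'I_n.+1 -> 'I_X}) k : k != 0 ->
  boxelt W (center n C W X) s 0 k = (W * s k)%N%:Z.
Proof. by move=> /negPf k0; rewrite !mxE k0 andbF mulr0 add0r PoszM. Qed.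

Lemma boxelt_lower n (G : {poly int}) C W X (s : {ffun 'I_n.+1 -> 'I_X}) :
  norm_lower n G C -> (0 < W)%N ->
  (X ^ n.+1 <= `|\det (opmx G (boxelt W (center n C W X) s))|)%N.
Proof.
move=> NL W0; apply: (NL _ (W * X)%N) => [k k0|].
  by rewrite boxelt_centerS // absz_nat leq_mul2l ltnW ?orbT.
rewrite boxelt_center0 lez_nat (leq_trans _ (leq_addr _ _)) //.
have -> : (W * (C.+1 * X) = C * (W * X) + W * X)%N by rewrite mulSn mulnDr mulnCA addnC.
by rewrite (leq_trans _ (leq_addl _ _)) // leq_add2l leq_pmull.
Qed.

Lemma boxelt_upper n (G : {poly int}) C W X (s : {ffun 'I_n.+1 -> 'I_X}) :
  norm_bound n G C -> (0 < X)%N ->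
  (`|\det (opmx G (boxelt W (center n C W X) s))| <=
     (C * (1 + W * C.+2)) ^ n.+1 * X ^ n.+1)%N.
Proof.
move=> [_ NC] X0; rewrite -expnMn -mulnA; apply: NC => k.
rewrite mulnDl mul1n; have sX := ltn_ord (s k).
have h : (W * s k <= W * X)%N by rewrite leq_mul2l ltnW ?orbT.
have e : (W * C.+2 * X = W * (C.+1 * X) + W * X)%N by rewrite -mulnDr -mulnA -mulSnr.
have [k0|k0] := eqVneq k 0.
  by rewrite k0 boxelt_center0 absz_nat e addnA -k0 leq_add // leq_add2r.
by rewrite boxelt_centerS // absz_nat (leq_trans h) // e addnA leq_addl.
Qed.

Lemma boxelt_coprime n (G : {poly int}) C W X (s : {ffun 'I_n.+1 -> 'I_X}) p :
  prime p -> (p %| W)%N ->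
  ~~ (p %| `|\det (opmx G (boxelt W (center n C W X) s))|)%N.
Proof.
move=> pp pW; have p1 := prime_gt1 pp.
have mdvd z := intr_eq0_dvd z (fun k => natr_Zp_eq0 k p1).
have W0 k : (W * k)%N%:R = 0 :> 'Z_p by apply/eqP; rewrite natr_Zp_eq0 // dvdn_mulr.
rewrite -mdvd map_det_opmx (_ : map_mx _ _ = delta_mx 0 0).
  rewrite /opmx (bigD1 0) //= big1 => [|k /negPf k0]; last first.
    by rewrite mxE k0 andbF scale0r.
  by rewrite mxE !eqxx scale1r expr0 addr0 det1 oner_eq0.
apply/rowP => k; rewrite [LHS]mxE [RHS]mxE eqxx /=; have [->|k0] := eqVneq k 0.
  by rewrite boxelt_center0 -pmulrn !natrD !W0 !addr0.
by rewrite boxelt_centerS // -pmulrn W0.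
Qed.

(** This loses a constant factor but imposes no upper limit on [p]; it serves the primes above
    [m ^ n.+1] in [root_sum_ineq]. *)
Lemma root_class_le n (G : {poly int}) C X W p (o : 'rV[int]_n.+1) (r : int) :
  G \is monic -> size G = n.+2 -> norm_bound n G C ->
  (forall a : 'rV[int]_n.+1, a != 0 -> \det (opmx G a) != 0) ->
  prime p -> ~~ (p %| W)%N -> (p %| `|G.[r]|)%N ->
  (#|[set s : {ffun 'I_n.+1 -> 'I_X} | (p %| `|ev (boxelt W o s) r|)%N]| * p
     <= (2 * C) ^ n.+1 * X ^ n.+1 + 2 ^ n.+1 * p)%N.
Proof.
move=> mG sG NC N0 pp pW Gr; apply: (card_class NC N0); first exact: prime_gt0.
move=> s t; rewrite !inE => sA tA; apply: (root_dvd_det mG sG (prime_gt1 pp) Gr).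
have : (p%:Z %| ev (boxelt W o s) r - ev (boxelt W o t) r)%Z by apply: rpredB.
rewrite -evB boxeltB evZ Gauss_dvdzr // /coprimez /gcdz /= eqz_nat.
by rewrite -/(coprime _ _) prime_coprime.
Qed.

(** A prime dividing the norm does not divide [W], hence not [D], and its square does not divide the
    norm; so [good_root] supplies a root and the inner sum is at least 1. *)
Lemma ln_norm_good (R : realType) n (G : {poly int}) (D : int) C W X Q
    (s : {ffun 'I_n.+1 -> 'I_X}) :
  let a := boxelt W (center n C W X) s in
  G \is monic -> size G = n.+2 -> separable_at G D -> (`|D| %| W)%N ->
  (0 < `|\det (opmx G a)| <= Q)%N ->
  (forall p, prime p -> ~~ (p ^ 2 %| `|\det (opmx G a)|)%N) ->
  ln `|\det (opmx G a)|%N%:R <=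
  \sum_(0 <= p < Q.+1 | prime p && ~~ (p %| W)%N) ln p%:R *
    \sum_(r < p | (p %| `|G.[(r : nat)%:Z]|)%N) (p %| `|ev a (r : nat)%:Z|)%N%:R :> R.
Proof.
move=> a mG sG sep DW /andP [N0 NQ] sf.
rewrite (ln_squarefree _ N0 NQ sf) big_mkcond [leRHS]big_mkcond /=.
apply: ler_sum => p _; case: ifP => [/andP [pp pN]|_]; last first.
  case: ifP => // _; rewrite mulr_ge0 ?ln_nat_ge0 // sumr_ge0 // => r _.
have pW : ~~ (p %| W)%N.
  by apply: contraL pN => pW; apply: boxelt_coprime.
have pD : ~~ (p %| `|D|)%N by apply: contra pW => /dvdn_trans; apply.
rewrite pp pW /= ler_peMr ?ln_nat_ge0 //.
have [r [rp Gr ar]] := good_root mG sG sep pp pD pN (sf p pp).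
rewrite (bigD1 (Ordinal rp)) //= ar lerDl sumr_ge0 // => r' _.
Qed.

Definition badset n (G : {poly int}) W X (o : 'rV[int]_n.+1) P :=
  [set s : {ffun 'I_n.+1 -> 'I_X} | [exists p : 'I_P.+1, prime p &&
     (p ^ 2 %| `|\det (opmx G (boxelt W o s))|)%N]].

Lemma card_badset (R : realType) n (G : {poly int}) (D : int) C X K W P :
  let o := center n C W X in
  G \is monic -> size G = n.+2 -> separable_at G D ->
  norm_bound n G C -> (forall a : 'rV[int]_n.+1, a != 0 -> \det (opmx G a) != 0) ->
  (`|D| %| W)%N -> (0 < K)%N -> (forall p, prime p -> (p <= K)%N -> (p %| W)%N) ->
  #|badset G W X o P|%:R <=
    (n.+1 ^ 2 + n.+1)%N%:R * (((2 * C) ^ n.+1 * X ^ n.+1)%N%:R / K%:R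
      + (2 ^ n.+1 * P)%N%:R) :> R.
Proof.
move=> o mG sG sep NC N0 DW K0 KW.
pose A (p : nat) := [set s : {ffun 'I_n.+1 -> 'I_X} |
  prime p && (p ^ 2 %| `|\det (opmx G (boxelt W o s))|)%N].
set E := (n.+1 ^ 2 + n.+1)%N; set M := ((2 * C) ^ n.+1 * X ^ n.+1)%N.
have Asmall p : (p <= K)%N -> A p = finset.set0.
  move=> pK; apply/setP => s; rewrite !inE; apply/negP => /andP [pp].
  move=> /(dvdn_trans (dvdn_exp2l p (isT : (1 <= 2)%N))); rewrite expn1 => pN.
  by have := boxelt_coprime (n := n) G C s pp (KW _ pp pK); rewrite pN.
have Abig p : (K < p)%N -> #|A p|%:R <= E%:R * (M%:R * (p%:R ^+ 2)^-1 + (2 ^ n.+1)%N%:R) :> R.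
  move=> Kp; have [pp|np] := boolP (prime p); last first.
    rewrite (_ : A p = finset.set0) ?cards0; last by apply/setP => s; rewrite !inE (negPf np).
    by rewrite !(mulr_ge0, addr_ge0, invr_ge0) ?exprn_ge0.
  have p0 : (0 : R) < p%:R ^+ 2 by rewrite exprn_gt0 // ltr0n prime_gt0.
  have [pW|pW] := boolP (p %| W)%N.
    rewrite (_ : A p = finset.set0) ?cards0; last first.
      apply/setP => s; rewrite !inE; apply/negP => /andP [_].
      move=> /(dvdn_trans (dvdn_exp2l p (isT : (1 <= 2)%N))); rewrite expn1 => pN.
      by have := boxelt_coprime (n := n) G C s pp pW; rewrite pN.
    by rewrite !(mulr_ge0, addr_ge0, invr_ge0) ?exprn_ge0.
  have pD : ~~ (p %| `|D|)%N by apply: contra pW => /dvdn_trans; apply.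
  have := card_bad X o mG sG sep NC N0 pp pD pW.
  rewrite (_ : [set s | _] = A p); last by apply/setP => s; rewrite !inE pp.
  rewrite -(ler_nat R) natrM natrX -ler_pdivlMr // => /le_trans; apply.
  rewrite natrM -mulrA ler_wpM2l // natrD mulrDl lerD2l.
  by rewrite [(_ * p ^ 2)%:R]natrM (natrX _ p) mulfK ?gt_eqF.
apply: (@le_trans _ _ (\sum_(p < P.+1) #|A p|)%N%:R).
  rewrite ler_nat; apply: leq_trans (card_bigcup_leq _); apply: subset_leq_card.
  apply/fintype.subsetP => s; rewrite inE => /existsP [p sp]; apply/bigcupP; exists p => //.
  by rewrite inE.
rewrite -(big_mkord xpredT (fun p => #|A p|)) natr_sum.
have [PK|KP] := leqP P.+1 K.+1.
  rewrite big_nat_cond big1 => [|p /andP [/andP [_ pP] _]]; last first.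
    by rewrite Asmall ?cards0 // -ltnS (leq_trans pP).
  by rewrite !(mulr_ge0, addr_ge0, invr_ge0).
rewrite (big_cat_nat (n := K.+1)) ?(ltnW KP) //= [X in X + _]big_nat_cond big1; last first.
  by move=> p /andP [/andP [_ pP] _]; rewrite Asmall ?cards0.
rewrite add0r; apply: (@le_trans _ _
   (\sum_(K.+1 <= p < P.+1) E%:R * (M%:R * (p%:R ^+ 2)^-1 + (2 ^ n.+1)%N%:R))).
  by apply: ler_sum_nat => p /andP [Kp _]; apply: Abig.
rewrite -mulr_sumr ler_wpM2l // big_split /= -mulr_sumr lerD //.
  by rewrite ler_wpM2l // sum_inv_sqr_le.
rewrite sumr_const_nat -mulrnA ler_nat.
by rewrite leq_mul2l subSS leq_subr orbT.
Qed.

(** * The lower half of Mertens' theorem for roots modulo primes *)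

(** [c0] will be the absolute leading coefficient of [F]: at its prime divisors the roots of [F] and
    of [monicize n F] need not correspond. *)
Definition root_sum (R : realType) (G : {poly int}) c0 z : R :=
  \sum_(0 <= p < z.+1 | prime p && ~~ (p %| c0)%N) (nroots G p)%:R * ln p%:R / p%:R.

(** The order of quantifiers matters: [c2] depends on [K] through [W], and [V] on [K] and [L], but
    neither on [m]. As [m] grows, only the losses governed by [K] and [L] persist relative to the
    logarithm. *)
Lemma root_sum_ineq (R : realType) n (G : {poly int}) (c0 : nat) :
  (0 < n)%N -> (0 < c0)%N -> G \is monic -> size G = n.+2 -> bezout_irreducible n G ->
  exists c1 C6 : nat, forall K : nat, (0 < K)%N -> exists c2 : nat,
  forall L : nat, (0 < L)%N -> exists V : R, forall m : nat, (0 < m)%N ->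
    (1 - c1%:R / K%:R - c2%:R / (L * m)%N%:R) * (n.+1%:R * ln (L * m)%N%:R) <=
    (1 + C6%:R / L%:R) ^+ n.+1 * root_sum R G c0 (m ^ n.+1) + V.
Proof.
move=> n0 c00 mG sG iG.
have [D [D0 sep]] := bezout_separable mG sG iG.
have [C [C0 NC' NL]] := opmx_det_bounds mG sG iG.
have NC : norm_bound n G C by [].
have N0 a := opmx_det_neq0 (a := a) mG sG iG.
have [C5 C5P] := card_root_class mG sG N0.
set g := n.+1; pose E := (g ^ 2 + g)%N; pose c1 := (E * (2 * C) ^ g)%N.
exists c1, (2 * C5)%N => K K0.
(* [K!] removes the small primes, [D] those at which [G] may be inseparable, [c0] those left out of
   [root_sum]. *)
pose W := (K`! * (`|D| * c0))%N.
have W0 : (0 < W)%N by rewrite !muln_gt0 fact_gt0 absz_gt0 D0.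
have DW : (`|D| %| W)%N by rewrite dvdn_mull // dvdn_mulr.
have cW : (c0 %| W)%N by rewrite dvdn_mull // dvdn_mull.
have KW p : prime p -> (p <= K)%N -> (p %| W)%N.
  by move=> pp pK; rewrite dvdn_mulr // dvdn_fact // prime_gt0.
pose U := ((C * (1 + W * C.+2)) ^ g)%N.
have U0 : (0 < U)%N by rewrite expn_gt0 muln_gt0 C0.
exists (E * 2 ^ g * U)%N => L L0.
pose V0 := ((2 * C) ^ g + 2 ^ g * U)%N.
exists ((g * V0 * L ^ g * U)%N%:R * ln 4) => m m0.
set X := (L * m)%N; have X0 : (0 < X)%N by rewrite muln_gt0 L0.
(* [Q] bounds all norms. As [n >= 1], [P ^ 2 >= Q], so [p ^ 2] divides a norm only if [p <= P]; and
   [P] is [O(X ^ n)], negligible against the [X ^ g] points. *)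
pose Q := (U * X ^ g)%N; pose Y := (m ^ g)%N; pose P := (U * X ^ n)%N.
pose o := center n C W X.
pose N (s : {ffun 'I_n.+1 -> 'I_X}) := `|\det (opmx G (boxelt W o s))|%N.
have Xg0 : (0 : R) < (X ^ g)%N%:R by rewrite ltr0n expn_gt0 X0.
have NX s : (X ^ g <= N s)%N by apply: boxelt_lower.
have NQ s : (N s <= Q)%N by apply: boxelt_upper.
have Ns0 s : (0 < N s)%N by apply: leq_trans (NX s); rewrite expn_gt0 X0.
have bad_small s : s \notin badset G W X o P -> forall p, prime p -> ~~ (p ^ 2 %| N s)%N.
  rewrite inE negb_exists => /forallP h p pp; apply/negP => pN.
  have pP : (p < P.+1)%N.
    rewrite ltnS leqNgt; apply/negP => Pp.
    have := leq_trans (dvdn_leq (Ns0 s) pN) (NQ s); rewrite leqNgt => /negP; apply.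
    apply: (@leq_ltn_trans (P ^ 2)); last by rewrite ltn_exp2r.
    rewrite /P expnMn -expnM leq_mul //; first by rewrite -[leqLHS]expn1 leq_pexp2l.
    by rewrite leq_pexp2l // /g; move: n0; clear; lia.
  by have := h (Ordinal pP); rewrite /= pp pN.
set B := badset G W X o P in bad_small.
have cB := card_badset R X P mG sG sep NC N0 DW K0 KW; rewrite -/o -/B -/g -/E in cB.
pose cls p r := [set s : {ffun 'I_n.+1 -> 'I_X} | (p %| `|ev (boxelt W o s) r|)%N].
pose T p : R := \sum_(r < p | (p %| `|G.[(r : nat)%:Z]|)%N) #|cls p (r : nat)%:Z|%:R.
have T0 p : 0 <= T p by apply: sumr_ge0.
have lower : ((X ^ g)%N%:R - #|B|%:R) * (g%:R * ln X%:R) <=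
    \sum_(s in finset.setC B) ln (N s)%:R :> R.
  have -> : (X ^ g)%N%:R - #|B|%:R = #|finset.setC B|%:R :> R.
    by have := cardsC B; rewrite card_ffun !card_ord -/g => <-; rewrite natrD addrAC subrr add0r.
  have -> : #|finset.setC B|%:R * (g%:R * ln X%:R) =
      \sum_(s in finset.setC B) (g%:R * ln X%:R) :> R by rewrite sumr_const mulr_natl.
  by apply: ler_sum => s _; rewrite -ln_natX // ler_ln_nat.
have upper : \sum_(s in finset.setC B) ln (N s)%:R <=
    \sum_(0 <= p < Q.+1 | prime p && ~~ (p %| W)%N) ln p%:R * T p :> R.
  pose I (s : {ffun 'I_n.+1 -> 'I_X}) : R := \sum_(0 <= p < Q.+1 | prime p && ~~ (p %| W)%N) ln p%:R *
    \sum_(r < p | (p %| `|G.[(r : nat)%:Z]|)%N)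
       (p %| `|ev (boxelt W o s) (r : nat)%:Z|)%N%:R.
  have I0 s : 0 <= I s.
    by apply: sumr_ge0 => p _; rewrite mulr_ge0 ?ln_nat_ge0 // sumr_ge0.
  apply: (@le_trans _ _ (\sum_(s in finset.setC B) I s)).
    apply: ler_sum => s; rewrite finset.in_setC => /bad_small h.
    by apply: (@ln_norm_good R n G D C W X Q s mG sG sep DW _ h); rewrite Ns0 NQ.
  apply: (@le_trans _ _ (\sum_s I s)).
    by rewrite [leRHS](bigID (mem (finset.setC B))) /= lerDl sumr_ge0.
  rewrite /I exchange_big /=; apply: ler_sum => p _.
  rewrite -mulr_sumr ler_wpM2l ?ln_nat_ge0 // exchange_big /=; apply: ler_sum => r _.
  rewrite -natr_sum ler_nat /cls -sum1dep_card [leqRHS]big_mkcond /=.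
  by apply: leq_sum => s _; case: ifP.
have card_roots p (c : R) : \sum_(r < p | (p %| `|G.[(r : nat)%:Z]|)%N) c = (nroots G p)%:R * c.
  rewrite mulr_natl -sumr_const; apply: eq_bigl => r.
  by rewrite inE.
(* [card_root_class] is used with side [m.+1], since [p <= m ^ g < m.+1 ^ g]. Its excess [C5 * m.+1]
   is at most [X * (2 * C5 / L)], so the factor is close to 1 for large [L]. *)
have small p : prime p -> ~~ (p %| W)%N -> (p <= Y)%N ->
    T p <= (nroots G p)%:R * ((X ^ g)%N%:R * (1 + (2 * C5)%N%:R / L%:R) ^+ g / p%:R).
  move=> pp pW pY; rewrite -card_roots; apply: ler_sum => r Gr.
  have p0 : (0 : R) < p%:R by rewrite ltr0n prime_gt0.
  rewrite ler_pdivlMr // -natrM.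
  have mp : (0 < p < m.+1 ^ g)%N.
    by rewrite prime_gt0 //= (leq_ltn_trans pY) // ltn_exp2r.
  have cpW : coprime p W by rewrite prime_coprime.
  have := C5P p m.+1 X W o _ mp cpW Gr; rewrite -/g -/(cls p (r : nat)%:Z) -(ler_nat R).
  move/le_trans; apply; rewrite !natrX -exprMn.
  apply: lerXn2r; rewrite ?nnegrE // ?mulr_ge0 ?addr_ge0 ?mulr_ge0 ?invr_ge0 //.
  have L0' : (0 : R) < L%:R by rewrite ltr0n.
  have -> : X%:R * (1 + (2 * C5)%N%:R / L%:R) = (X + C5 * (2 * m))%N%:R :> R.
    by rewrite /X !(natrD, natrM); field; rewrite gt_eqF.
  by rewrite ler_nat leq_add2l leq_mul2l; apply/orP; right; clear -m0; lia.
have big p : prime p -> ~~ (p %| W)%N -> (Y < p <= Q)%N -> T p <= (g * V0 * L ^ g)%N%:R.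
  move=> pp pW /andP [Yp pQ].
  apply: (@le_trans _ _ (\sum_(r < p | (p %| `|G.[(r : nat)%:Z]|)%N) (V0 * L ^ g)%N%:R)).
    apply: ler_sum => r Gr; rewrite ler_nat -(leq_pmul2r (prime_gt0 pp)).
    apply: leq_trans (root_class_le X o mG sG NC N0 pp pW Gr) _.
    apply: (@leq_trans (V0 * X ^ g)).
      by rewrite /V0 mulnDl leq_add2l -mulnA leq_mul2l pQ orbT.
    by rewrite -mulnA leq_mul2l /X expnMn leq_mul2l (ltnW Yp) !orbT.
  by rewrite card_roots -natrM ler_nat -mulnA leq_mul2r (nroots_le mG sG pp) orbT.
have YQ : (Y <= Q)%N.
  by rewrite /Y /Q /X expnMn mulnA leq_pmull // muln_gt0 U0 expn_gt0 L0.
rewrite (big_cat_nat (n := Y.+1)) //= in upper.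
have up1 : \sum_(0 <= p < Y.+1 | prime p && ~~ (p %| W)%N) ln p%:R * T p <=
    (X ^ g)%N%:R * ((1 + (2 * C5)%N%:R / L%:R) ^+ g * root_sum R G c0 Y).
  rewrite mulrA /root_sum mulr_sumr big_mkcond [leRHS]big_mkcond /=.
  apply: ler_sum_nat => p /andP [_ pY]; case: ifP => [/andP [pp pW]|_]; last first.
    by case: ifP => // _; rewrite !(mulr_ge0, addr_ge0, exprn_ge0, invr_ge0, ln_nat_ge0).
  have -> : ~~ (p %| c0)%N by apply: contra pW => /dvdn_trans; apply.
  rewrite pp /=; apply: le_trans (ler_wpM2l (ln_nat_ge0 R p) (small p pp pW pY)) _.
  by rewrite le_eqVlt; apply/orP; left; apply/eqP; ring.
(* A class has [O(X ^ g / p)] points, which is [O(L ^ g)] for [p > (X / L) ^ g]. Chebyshev's bound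
   up to [Q = O(X ^ g)] then gives a total without logarithm, absorbed in [V]. *)
have up2 : \sum_(Y.+1 <= p < Q.+1 | prime p && ~~ (p %| W)%N) ln p%:R * T p <=
    (X ^ g)%N%:R * ((g * V0 * L ^ g * U)%N%:R * ln 4).
  apply: (@le_trans _ _ (\sum_(Y.+1 <= p < Q.+1 | prime p) ln p%:R * (g * V0 * L ^ g)%N%:R)).
    rewrite big_mkcond [leRHS]big_mkcond /=; apply: ler_sum_nat => p pYQ.
    case: ifP => [/andP [pp pW]|_].
      by rewrite pp ler_wpM2l ?ln_nat_ge0 // big.
    by case: ifP => // _; rewrite mulr_ge0 ?ln_nat_ge0.
  rewrite -mulr_suml; apply: (@le_trans _ _ ((Q%:R * ln 4) * (g * V0 * L ^ g)%N%:R)).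
    rewrite ler_wpM2r //; apply: le_trans (chebyshev_theta_le R Q).
    rewrite [leRHS](big_cat_nat (n := Y.+1)) //= lerDr sumr_ge0 // => p _.
    exact: ln_nat_ge0.
  rewrite le_eqVlt; apply/orP; left; apply/eqP; rewrite /Q !natrM; ring.
have tot := le_trans lower (le_trans upper (lerD up1 up2)).
rewrite -mulrDr in tot; rewrite -(ler_pM2l Xg0); apply: le_trans tot.
rewrite mulrA ler_wpM2r ?mulr_ge0 ?ln_nat_ge0 //.
apply: le_trans (lerB (lexx _) cB).
have X0' : (0 : R) < X%:R by rewrite ltr0n.
have K0' : (0 : R) < K%:R by rewrite ltr0n.
have e1 : c1%:R = E%:R * ((2 * C) ^ g)%N%:R :> R by rewrite natrM.
have e2 : (E * 2 ^ g * U)%N%:R = E%:R * (2 ^ g)%N%:R * U%:R :> R by rewrite natrM [(E * _)%:R]natrM.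
have e3 : ((2 * C) ^ g * X ^ g)%N%:R = ((2 * C) ^ g)%N%:R * (X ^ g)%N%:R :> R by rewrite natrM.
have e4 : (2 ^ g * P)%N%:R = (2 ^ g)%N%:R * (U%:R * X%:R ^+ n) :> R by rewrite natrM [(U * _)%:R]natrM (natrX _ X).
have e5 : (X ^ g)%N%:R = X%:R * X%:R ^+ n :> R by rewrite (natrX _ X) exprS.
rewrite e1 e2 e3 e4 e5 le_eqVlt; apply/orP; left; apply/eqP.
by field; rewrite !gt_eqF.
Qed.

Lemma exists_nat_gt (R : realType) (x : R) : exists K : nat, (0 < K)%N /\ x < K%:R.
Proof.
exists (Num.bound `|x|).+1; split => //.
apply: le_lt_trans (ler_norm x) _; apply: lt_trans (archi_boundP (normr_ge0 x)) _.
by rewrite ltr_nat.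
Qed.

(** Convexity: on [[0, 1]] the power lies below its chord. *)
Lemma exp1D_le (R : realType) (d : R) k : 0 <= d <= 1 ->
  (1 + d) ^+ k <= 1 + d * (2 ^+ k - 1).
Proof.
move=> /andP [d0 d1]; elim: k => [|k IH]; first by rewrite !expr0 subrr mulr0 addr0.
rewrite exprS; apply: le_trans (ler_wpM2l _ IH) _; first by lra.
have : 1 <= 2 ^+ k :> R by rewrite exprn_ege1 // ler1n.
rewrite exprS; move: (2 ^+ k) => t t1.
have : 0 <= d * (1 - d) * (t - 1) by rewrite !mulr_ge0 // subr_ge0.
by move: d0 d1 t1; clear; nra.
Qed.

Lemma root_sum_ge0 (R : realType) (G : {poly int}) c0 z : 0 <= root_sum R G c0 z.
Proof.
by apply: sumr_ge0 => p _; rewrite !(mulr_ge0, invr_ge0, ln_nat_ge0).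
Qed.

Lemma root_sum_mono (R : realType) (G : {poly int}) c0 y z : (y <= z)%N ->
  root_sum R G c0 y <= root_sum R G c0 z.
Proof.
move=> yz; rewrite /root_sum [leRHS](big_cat_nat (n := y.+1)) //= lerDl.
by apply: sumr_ge0 => p _; rewrite !(mulr_ge0, invr_ge0, ln_nat_ge0).
Qed.

Lemma root_sum_lower (R : realType) n (G : {poly int}) (c0 : nat) (eps : R) :
  (0 < n)%N -> (0 < c0)%N -> G \is monic -> size G = n.+2 -> bezout_irreducible n G ->
  0 < eps < 1 ->
  exists Z : nat, forall z : nat, (Z <= z)%N ->
    (1 - eps) * ln z%:R <= root_sum R G c0 z.
Proof.
move=> n0 c00 mG sG iG /andP [e0 e1].
have [c1 [C6 h]] := root_sum_ineq R n0 c00 mG sG iG.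
have [K [K0 c1K]] := exists_nat_gt (4 * c1%:R / eps).
have [c2 {}h] := h K K0.
have [L1 [L10 hL1]] := exists_nat_gt (4 * C6%:R * 2 ^+ n.+1 / eps).
(* [C6] ensures [C6 / L <= 1] for [exp1D_le], [L1] brings the power within [eps / 4] of 1, and
   [L >= 2] gives [m.+1 <= L * m], whence [z < (L * m) ^ n.+1]. *)
pose L := (L1 + C6 + 1)%N; have L0 : (0 < L)%N by rewrite /L addn1.
have [V {}h] := h L L0.
have [M [M0 hM]] := exists_nat_gt (4 * c2%:R / eps).
have [Z1 [Z10 hZ1]] := exists_nat_gt (expR (4 * V / eps)).
exists (maxn (M ^ n.+1) Z1) => z; rewrite geq_max => /andP [Mz Z1z].
have z0 : (0 < z)%N by apply: leq_trans Z1z.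
have bnd m : (m ^ n.+1 <= z)%N -> (m <= z)%N.
  move/(leq_trans _); apply; case: m => // m; by rewrite -[leqLHS]expn1 leq_pexp2l.
case: (ex_maxnP (ex_intro _ M Mz) bnd) => m mz mmax.
have Mm : (M <= m)%N by apply: mmax.
have m0 : (0 < m)%N by apply: leq_trans Mm.
have zm : (z < m.+1 ^ n.+1)%N.
  by rewrite ltnNge; apply/negP => /mmax; rewrite ltnn.
have e0' : eps != 0 by rewrite gt_eqF.
(* Four losses of [eps / 4], due to [K], [M], [L] and [Z1], fit the budget because [(1 + eps / 4) *
   (1 - eps) <= 1 - 3 * eps / 4]. *)
have d1 : c1%:R / K%:R <= eps / 4.
  rewrite ler_pdivrMr ?ltr0n //; move: c1K; rewrite ltr_pdivrMr // => c1K.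
  by rewrite mulrAC ler_pdivlMr //; move: c1K; clear; lra.
have d2 : c2%:R / (L * m)%N%:R <= eps / 4.
  rewrite ler_pdivrMr ?ltr0n ?muln_gt0 ?L0 //; move: hM; rewrite ltr_pdivrMr // => hM.
  have : M%:R <= (L * m)%N%:R :> R by rewrite ler_nat (leq_trans Mm) // leq_pmull.
  move: (M%:R) ((L * m)%N%:R) hM => a b ab ab'; nra.
have L0' : (0 : R) < L%:R by rewrite ltr0n.
have d3 : (1 + C6%:R / L%:R) ^+ n.+1 <= 1 + eps / 4.
  have le1 : C6%:R / L%:R <= 1 :> R.
    by rewrite ler_pdivrMr // mul1r ler_nat /L addn1 addnC ltnW // ltnS leq_addr.
  apply: le_trans (exp1D_le _ _) _; first by rewrite le1 divr_ge0.
  rewrite lerD2l; apply: (@le_trans _ _ (C6%:R / L%:R * 2 ^+ n.+1)).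
    by rewrite ler_wpM2l ?divr_ge0 // gerBl.
  rewrite mulrAC ler_pdivrMr //; move: hL1; rewrite ltr_pdivrMr // -mulrA => hL1.
  have : L1%:R <= L%:R :> R by rewrite ler_nat /L -addnA leq_addr.
  move: hL1; move: (L1%:R) (L%:R) (C6%:R * 2 ^+ n.+1) => a b c hc ab.
  have : 0 <= eps * (b - a) by rewrite mulr_ge0 ?subr_ge0 // ltW.
  by move: hc; clear; nra.
have hV : V <= eps / 4 * ln z%:R.
  have : 4 * V / eps <= ln z%:R.
    rewrite -[leLHS]expRK ler_ln ?posrE ?expR_gt0 ?ltr0n //.
    by apply: ltW; apply: lt_le_trans hZ1 _; rewrite ler_nat.
  by rewrite ler_pdivrMr //; clear; lra.
have lz0 := ln_nat_ge0 R z.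
have lzm : ln z%:R <= n.+1%:R * ln (L * m)%N%:R :> R.
  rewrite -ln_natX ?muln_gt0 ?L0 // ler_ln_nat // (leq_trans (ltnW zm)) // leq_exp2r //.
  rewrite /L; move: L10 m0; clear; nia.
have S0 := root_sum_ge0 R G c0 z.
have Smz := root_sum_mono R G c0 mz.
have {}h := h m m0.
have h1 : (1 - eps / 2) * ln z%:R <= (1 + eps / 4) * root_sum R G c0 z + eps / 4 * ln z%:R.
  apply: le_trans (le_trans _ h) _; last first.
    rewrite lerD // ler_pM ?root_sum_ge0 // exprn_ge0 // addr_ge0 // divr_ge0 //.
  apply: ler_pM => //; first by lra.
  lra.
rewrite -(@ler_pM2l _ (1 + eps / 4)); last by lra.
move: h1 lz0; move: (ln z%:R) (root_sum R G c0 z) => l S h1 l0.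
have : (1 + eps / 4) * (1 - eps) * l <= (1 - 3 * eps / 4) * l.
  by rewrite ler_wpM2r //; nra.
by move: h1; rewrite mulrA; clear; lra.
Qed.

(** * Chebyshev's device for the values of [F] *)

Lemma nroots_monicize n (F : {poly int}) p : size F = n.+2 -> prime p ->
  ~~ (p %| `|lead_coef F|)%N -> (nroots (monicize n F) p <= nroots F p)%N.
Proof.
move=> sF pp pc; rewrite !nroots_Fp //; set c := lead_coef F in pc.
have mdvd k := @natr_Fp_eq0 p k pp.
have c0 : c%:~R != 0 :> 'F_p by rewrite (intr_eq0_dvd _ mdvd).
rewrite -(card_imset _ (mulIf (invr_neq0 c0))); apply: subset_leq_card.
apply/fintype.subsetP => _ /imsetP [x Gx ->]; rewrite inE in Gx; rewrite inE.
have := congr1 (fun P => (map_poly intr P : {poly 'F_p}).[x / c%:~R]) (monicize_comp sF).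
rewrite map_comp_poly /= horner_comp !map_polyZ /= map_polyX !hornerZ hornerX -/c.
rewrite mulrC divfK // (eqP Gx) => /esym/eqP.
by rewrite mulf_eq0 rmorphXn /= expf_eq0 (negPf c0) andbF.
Qed.

(** Since [n >= 1], ['X - y%:P] is small enough for [monicize_bezout], which forbids a common root
    with [monicize n F] over the rationals. Hence each index is counted by exactly one of [Psi] and
    [rough]. *)
Lemma irreducible_no_int_root n (F : {poly int}) (x : int) : (0 < n)%N ->
  size F = n.+2 -> irreducible_poly F -> F.[x] != 0.
Proof.
move=> n0 sF irrF; apply/eqP => Fx.
pose y := lead_coef F * x.
have Gy : (monicize n F).[y] = 0 by rewrite monicize_horner // Fx mulr0.
have [||D [D0 /(_ rat y%:~R)]] := monicize_bezout sF irrF (B := 'X - y%:P).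
- by rewrite polyXsubC_eq0.
- by rewrite size_XsubC.
rewrite !horner_map /= Gy hornerXsubC subrr => /(_ erefl erefl) /eqP.
by rewrite intr_eq0 (negPf D0).
Qed.

Lemma count_residue p (r : 'I_p) N :
  (N %/ p <= \sum_(1 <= m < N.+1) (m %% p == r))%N.
Proof.
have p0 : (0 < p)%N by apply: leq_ltn_trans (ltn_ord r).
(* Indices start at 1, so the residue 0 is first attained at [p]. *)
pose r' := if r == 0 :> nat then p else r.
have r'p : (0 < r' <= p)%N.
  by rewrite /r'; case: eqP => [_|/eqP]; rewrite -?lt0n ?p0 ?leqnn // => ->; rewrite ltnW.
have r'r : (r' %% p = r)%N.
  by rewrite /r'; case: eqP => [->|_]; rewrite ?modnn ?modn_small.
pose s := [seq (j * p + r')%N | j <- iota 0 (N %/ p)].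
have us : uniq s.
  by rewrite map_inj_uniq ?iota_uniq // => i j /addIn /eqP; rewrite eqn_pmul2r // => /eqP.
rewrite -(size_iota 0 (N %/ p)) -(size_map (fun j => j * p + r')%N) -/s.
have -> : (\sum_(1 <= m < N.+1) (m %% p == r) =
    size [seq m <- index_iota 1 N.+1 | m %% p == r])%N.
  by rewrite size_filter -sum1_count [RHS]big_mkcond; apply: eq_bigr => m _; case: eqP.
apply: uniq_leq_size us _ => m /mapP [j]; rewrite mem_iota add0n /= => jN ->.
rewrite mem_filter mem_index_iota modnMDl r'r eqxx /= ltnS.
case/andP: r'p => r'0 r'p; rewrite addn_gt0 r'0 orbT /=.
apply: leq_trans (leq_divM N p); apply: (@leq_trans (j * p + p)); first by rewrite leq_add2l.
by rewrite -mulSnr leq_mul2r jN orbT.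
Qed.

Lemma count_roots (F : {poly int}) p N : (0 < p)%N ->
  (nroots F p * (N %/ p) <= \sum_(1 <= m < N.+1) (p %| `|F.[m%:Z]|))%N.
Proof.
move=> p0; rewrite /nroots -sum_nat_const.
apply: (@leq_trans (\sum_(r in [set r : 'I_p | (p %| `|F.[(r : nat)%:Z]|)%N])
   \sum_(1 <= m < N.+1) (m %% p == r))).
  by apply: leq_sum => r _; apply: count_residue.
rewrite exchange_big /=; apply: leq_sum => m _.
have mp : (m %% p < p)%N by rewrite ltn_mod.
have Fm : (p %| `|F.[(m %% p)%N%:Z]|)%N = (p %| `|F.[m%:Z]|)%N.
  have h : (p%:Z %| F.[m%:Z] - F.[(m %% p)%N%:Z])%Z.
    apply: dvdz_trans (dvdz_horner_sub F _ _); apply/dvdzP; exists (m %/ p)%N%:Z.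
    by rewrite {1}(divn_eq m p) PoszD PoszM addrK.
  apply/idP/idP => pF.
    by suff : (p%:Z %| F.[m%:Z])%Z by []; rewrite -[F.[m%:Z]](subrK F.[(m %% p)%N%:Z]) rpredD.
  suff : (p%:Z %| F.[(m %% p)%N%:Z])%Z by [].
  by rewrite -[F.[(m %% p)%N%:Z]](subKr F.[m%:Z]) rpredB.
rewrite -Fm big_mkcond (bigD1 (Ordinal mp)) //= inE /= eqxx big1 ?addn0; last first.
  move=> r /negPf nr; case: ifP => // _; rewrite (_ : (_ == _) = false) //.
  by apply/eqP => e; move: nr; rewrite -val_eqE /= -e eqxx.
by case: ifP => // ->.
Qed.

Lemma horner_abs_le d (F : {poly int}) : size F = d.+1 ->
  exists A : nat, (0 < A)%N /\ forall m, (0 < m)%N -> (`|F.[m%:Z]| <= A * m ^ d)%N.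
Proof.
move=> sF; exists (\sum_(i < d.+1) `|(F`_i)%R|).+1%N; split => // m m0.
apply: (@leq_trans ((\sum_(i < d.+1) `|(F`_i)%R|) * m ^ d)); last by rewrite leq_mul2r leqnSn orbT.
rewrite -lez_nat abszE horner_coef sF; apply: le_trans (ler_norm_sum _ _ _) _.
rewrite big_distrl /= rmorph_sum; apply: ler_sum => i _.
rewrite normrM -!abszE -PoszM lez_nat leq_mul2l; apply/orP; right.
by rewrite abszX absz_nat leq_pexp2l // -ltnS.
Qed.

(** A largest prime factor [q > y >= z] lies outside the range of the sum, so it can be split off:
    the primes up to [z] dividing [f] already divide [f / q]. *)
Lemma ln_value_bound (R : realType) (P : pred nat) (f z : nat) (y : R) :
  (0 < f)%N -> 1 <= y -> z%:R <= y ->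
  (~~ ((max_pdiv f)%:R <= y))%:R * ln y +
    \sum_(0 <= p < z.+1 | [&& prime p, P p & (p %| f)%N]) ln p%:R <= ln f%:R.
Proof.
move=> f0 y1 zy; case: (leP (max_pdiv f)%:R y) => [_|yq] /=; first by rewrite mulr0n mul0r add0r sum_ln_dvd_le.
rewrite mulr1n mul1r; set q := max_pdiv f in yq *.
have f1 : (1 < f)%N.
  by rewrite ltnNge; apply/negP => f1; move: yq; rewrite /q (_ : f = 1%N) ?ltNge ?y1 //; lia.
have qp : prime q by apply: max_pdiv_prime.
have qf : (q %| f)%N by apply: max_pdiv_dvd.
clearbody q.
pose f' := (f %/ q)%N; have fE : f = (q * f')%N by rewrite mulnC divnK.
have f'0 : (0 < f')%N.
  by rewrite divn_gt0; [apply: dvdn_leq f0 qf | apply: prime_gt0].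
clearbody f'.
have q0 := prime_gt0 qp.
rewrite [in leRHS]fE ln_natM // lerD //.
  by rewrite ler_ln ?posrE ?ltr0n // ?(ltW yq) // (lt_le_trans _ y1).
apply: le_trans (sum_ln_dvd_le R z P f'0).
rewrite big_nat_cond [leRHS]big_nat_cond big_mkcond [leRHS]big_mkcond /=.
apply: ler_sum => p _; case: ifP => [/andP [pz /and3P [pp Pp pf]]|_]; last first.
  by case: ifP => // _; apply: ln_nat_ge0.
rewrite pz pp Pp /=; suff -> : (p %| f')%N by [].
move: pf; rewrite fE Euclid_dvdM // dvdn_prime2 // => /predU1P [pq|//].
by move: yq; rewrite -pq ltNge (le_trans _ zy) // ler_nat -ltnS.
Qed.

Definition rough (R : realType) (F : {poly int}) (N : nat) (y : R) : nat :=
  (\sum_(1 <= m < N.+1) ~~ ((max_pdiv `|F.[m%:Z]|)%:R <= y)%R)%N.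

Lemma Psi_rough (R : realType) (F : {poly int}) (x y : R) :
  (forall m : int, F.[m] != 0) ->
  (Psi F x y + rough F (Num.truncn x) y)%N = Num.truncn x.
Proof.
move=> F0; rewrite /Psi /rough -sum1_count big_mkcond /= -big_split /=.
rewrite (eq_bigr (fun=> 1%N)) => [|m _]; last by rewrite F0 /=; case: (_ <= y).
by rewrite sum_nat_const_nat subn1 muln1.
Qed.

Lemma rough_bound (R : realType) n (F : {poly int}) (A N T : nat) (x y : R) :
  (0 < A)%N -> (forall m, (0 < m)%N -> (`|F.[m%:Z]| <= A * m ^ n.+1)%N) ->
  (forall m : int, F.[m] != 0) -> size F = n.+2 ->
  (0 < T)%N -> 1 <= x -> N%:R <= x -> x <= y ->
  (rough F N y)%:R * ln y +
    N%:R * ((1 - T%:R^-1) * root_sum R (monicize n F) `|lead_coef F|%N (N %/ T)) <=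
  N%:R * (ln A%:R + n.+1%:R * ln x).
Proof.
move=> A0 FA F0 sF T0 x1 Nx xy.
have y1 : 1 <= y by apply: le_trans xy.
set z := (N %/ T)%N; set c := `|lead_coef F|%N.
have zy : z%:R <= y by rewrite (le_trans _ (le_trans Nx xy)) // ler_nat leq_div.
pose f m := `|F.[m%:Z]|%N; pose Pc p := ~~ (p %| c)%N.
have f0 m : (0 < f m)%N by rewrite absz_gt0.
have step m : (0 < m <= N)%N -> (~~ ((max_pdiv (f m))%:R <= y))%:R * ln y +
    \sum_(0 <= p < z.+1 | [&& prime p, Pc p & (p %| f m)%N]) ln p%:R <=
    ln A%:R + n.+1%:R * ln x.
  move=> /andP [m0 mN]; apply: le_trans (ln_value_bound Pc (f0 m) y1 zy) _.
  apply: (@le_trans _ _ (ln (A * m ^ n.+1)%N%:R)); first by rewrite ler_ln_nat // FA.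
  rewrite ln_natM ?expn_gt0 ?m0 // lerD2l ln_natX // ler_wpM2l //.
  rewrite ler_ln ?posrE ?ltr0n ?(lt_le_trans _ x1) //.
  by apply: le_trans Nx; rewrite ler_nat.
have tot : \sum_(1 <= m < N.+1) ((~~ ((max_pdiv (f m))%:R <= y))%:R * ln y +
    \sum_(0 <= p < z.+1 | [&& prime p, Pc p & (p %| f m)%N]) ln p%:R) <=
    N%:R * (ln A%:R + n.+1%:R * ln x).
  rewrite mulr_natl; apply: (@le_trans _ _ (\sum_(1 <= m < N.+1) (ln A%:R + n.+1%:R * ln x))).
    by apply: ler_sum_nat => m /andP [m0 mN]; apply: step; rewrite m0 -ltnS.
  by rewrite sumr_const_nat subn1.
apply: le_trans tot; rewrite big_split /= -mulr_suml -natr_sum lerD2l.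
have -> : \sum_(1 <= m < N.+1)
     \sum_(0 <= p < z.+1 | [&& prime p, Pc p & (p %| f m)%N]) ln p%:R =
   \sum_(0 <= p < z.+1 | prime p && Pc p)
     ln p%:R * (\sum_(1 <= m < N.+1) (p %| f m))%N%:R :> R.
  under eq_bigr do under eq_bigl do rewrite andbA.
  under eq_bigr do rewrite big_mkcondr.
  rewrite exchange_big /=; apply: eq_bigr => p _.
  rewrite natr_sum mulr_sumr; apply: eq_bigr => m _.
  by case: (p %| f m)%N; rewrite ?mulr1 ?mulr0.
rewrite mulrA /root_sum mulr_sumr [leLHS]big_nat_cond [leRHS]big_nat_cond.
apply: ler_sum => p /andP [/andP [_ pz] /andP [pp pc]].
have p0 : (0 : R) < p%:R by rewrite ltr0n prime_gt0.
have T0' : (0 : R) < T%:R by rewrite ltr0n.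
(* Rounding [N / p] down costs at most 1, and [1 <= (N / p) / T] for [p <= N / T]. This is the
   purpose of the cut at [N %/ T]. *)
have hdiv : N%:R * (1 - T%:R^-1) / p%:R <= (N %/ p)%N%:R :> R.
  rewrite ler_pdivrMr // mulrBr mulr1.
  have h1 : N%:R <= (N %/ p)%N%:R * p%:R + p%:R :> R.
    by rewrite -natrM -natrD ler_nat -mulSnr ltnW // ltn_ceil // prime_gt0.
  have h2 : p%:R <= N%:R / T%:R :> R.
    by rewrite ler_pdivlMr // -natrM ler_nat -leq_divRL.
  by move: h1 h2; clear; lra.
have hr : ((nroots (monicize n F) p)%:R * (N %/ p)%N%:R <=
     (\sum_(1 <= m < N.+1) (p %| f m))%N%:R :> R).
  rewrite -natrM ler_nat; apply: leq_trans (count_roots F N (prime_gt0 pp)).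
  by rewrite leq_mul2r nroots_monicize // orbT.
rewrite [leLHS](_ : _ = ln p%:R * ((nroots (monicize n F) p)%:R *
   (N%:R * (1 - T%:R^-1) / p%:R))); last by ring.
apply: ler_wpM2l; first exact: ln_nat_ge0.
by apply: le_trans hr; apply: ler_wpM2l.
Qed.

(** Here [W] is the [rough] count, [a = ln A], [t = ln (4 T)], [d = 1 / T] and [lz] is the logarithm
    of the cut. Three [eps] pay for the errors in [W], reduced by [u <= 1]; the fourth pays for
    replacing [x] by its integer part [N]. *)
Lemma Psi_lower_arith (R : realType) (g N W x l ly a t lz d eps u : R) :
  2 <= g -> 0 < eps < 1/4 -> 0 < l -> (g - 1) * l <= ly -> u = l / ly ->
  0 <= d <= eps -> l - t <= lz -> 0 <= lz -> 0 <= a -> 0 <= t -> a + t <= eps * l ->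
  x - 1 <= N -> N <= x -> 0 <= N -> 1 <= eps * x ->
  W * ly + N * ((1 - d) * ((1 - eps) * lz)) <= N * (a + g * l) ->
  (1 + u - g * u - 4 * eps) * x <= N - W.
Proof.
move=> g2 /andP [e0 e1] l0 gly uE /andP [d0 de] lz1 lz0 a0 t0 at_ xN Nx N0 ex h.
have ly0 : 0 < ly by nra.
have le_l : l <= ly by nra.
have u1 : u <= 1 by rewrite uE ler_pdivrMr // mul1r.
have u0 : 0 <= u by rewrite uE divr_ge0 // ltW.
have gu : (g - 1) * u <= 1 by rewrite uE mulrA ler_pdivrMr // mul1r.
have c1 : 1 - 2 * eps <= (1 - d) * (1 - eps) by nra.
have c2 : (1 - 2 * eps) * (l - t) <= (1 - d) * ((1 - eps) * lz).
  rewrite mulrA; apply: (@le_trans _ _ ((1 - 2 * eps) * lz)).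
    by rewrite ler_wpM2l //; lra.
  by rewrite ler_wpM2r.
have c3 : a + g * l - (1 - d) * ((1 - eps) * lz) <= (g - 1 + 3 * eps) * l by nra.
have c4 : W * ly <= N * ((g - 1 + 3 * eps) * l).
  apply: le_trans (ler_wpM2l N0 c3); rewrite mulrBr.
  by move: h; clear; lra.
have c5 : W <= N * ((g - 1 + 3 * eps) * u).
  by rewrite uE !mulrA ler_pdivlMr // -!mulrA.
have c6 : W <= N * ((g - 1) * u + 3 * eps).
  apply: le_trans c5 _; rewrite ler_wpM2l // mulrDl lerD2l -[leRHS]mulr1 ler_wpM2l //.
  by lra.
suff : (1 - (g - 1) * u - 4 * eps) * x <= N * (1 - (g - 1) * u - 3 * eps).
  by move: c6; clear; nra.
have s0 : 0 <= 1 - (g - 1) * u by lra.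
have s1 : 1 - (g - 1) * u <= 1.
  by rewrite gerBl mulr_ge0 //; lra.
move: s0 s1 xN Nx ex e0 e1; set s := 1 - (g - 1) * u; clear; move=> s0 s1 xN Nx ex e0 e1.
have p1 : 0 <= s * (N - x + 1) by rewrite mulr_ge0 //; lra.
have p2 : 0 <= eps * (x - N) by rewrite mulr_ge0 //; lra.
nra.
Qed.

(** The threshold [X] depends on [eps] but not on [y]; the theorem needs this uniformity for an
    error depending on [x] alone. *)
Lemma Psi_lower (R : realType) n (F : {poly int}) (eps : R) :
  (0 < n)%N -> size F = n.+2 -> irreducible_poly F -> 0 < eps < 1 / 4 ->
  exists X : R, forall x : R, X <= x -> forall y : R, x ^+ n < y -> y <= x ^+ n.+1 ->
    let u := ln x / ln y in
    (1 + u - n.+1%:R * u - 4 * eps) * x <= (Psi F x y)%:R.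
Proof.
move=> n0 sF irrF eps01; have /andP [e0 e1] := eps01.
have F0 m : F.[m] != 0 := irreducible_no_int_root m n0 sF irrF.
have c0 : (0 < `|lead_coef F|)%N.
  by rewrite absz_gt0 lead_coef_eq0 -size_poly_eq0 sF.
have e01 : 0 < eps < 1 by rewrite e0; lra.
have [Z hZ] := root_sum_lower n0 c0 (monicize_monic n F) (monicize_size n F)
   (monicize_bezout sF irrF) e01.
have [A [A0 FA]] := horner_abs_le sF.
have [T [T0 hT]] := exists_nat_gt eps^-1.
have T0' : (0 : R) < T%:R by rewrite ltr0n.
(* Beyond [X1] the constants [ln A + ln (4 T)] are at most [eps * ln x]. *)
pose X1 := expR ((ln A%:R + ln (4 * T)%N%:R) / eps) : R.
exists ((T * Z.+1)%N%:R + 2 + eps^-1 + X1) => x Xx y xy yx /=.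
have X10 : 0 < X1 by apply: expR_gt0.
have ei0 : 0 < eps^-1 by rewrite invr_gt0.
have TZ0 : 0 <= (T * Z.+1)%N%:R :> R by [].
have x2 : 2 <= x by lra.
have x0 : 0 < x by lra.
have xn : x <= x ^+ n by rewrite ler_eXnr //; lra.
have xly : x <= y by lra.
have y0 : 0 < y by lra.
have l0 : 0 < ln x by rewrite ln_gt0 //; lra.
set N := Num.truncn x.
have /andP [Nx xN] : N%:R <= x < N.+1%:R by apply: truncn_itv; lra.
have xN' : x - 1 <= N%:R by move: xN; rewrite -addn1 natrD; lra.
have TZN : (T * Z.+1 <= N)%N by rewrite -ltnS -(ltr_nat R); lra.
have zZ : (Z.+1 <= N %/ T)%N by rewrite leq_divRL // mulnC.
set z := (N %/ T)%N in zZ.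
have z0 : (0 < z)%N by apply: leq_trans zZ.
have N1 : (0 < N)%N by apply: leq_trans TZN; rewrite muln_gt0 T0.
have rb := rough_bound A0 FA F0 sF T0 (le_trans (ler1n R 2) x2) Nx xly.
have d1 : 0 <= (T%:R^-1 : R) <= eps.
  apply/andP; split; first by rewrite invr_ge0.
  by rewrite -[leRHS]invrK lef_pV2 ?posrE ?invr_gt0 // ltW.
have Psi_eq : (Psi F x y)%:R = N%:R - (rough F N y)%:R :> R.
  have /(congr1 (fun k : nat => k%:R : R)) := Psi_rough x y F0.
  by rewrite -/N natrD => <-; rewrite addrK.
rewrite Psi_eq.
apply: (@Psi_lower_arith R n.+1%:R N%:R _ x (ln x) (ln y) (ln A%:R) (ln (4 * T)%N%:R)
   (ln z%:R) T%:R^-1 eps) => //.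
- by rewrite (ler_nat R 2).
- rewrite -natr1 addrK mulr_natl -lnXn // ler_ln ?posrE ?exprn_gt0 // ltW //.
(* The factor 4 comes from two roundings: [x < N + 1 <= 2 N] and [N < T (z + 1) <= 2 T z]. *)
- have xz : x <= (4 * T * z)%N%:R.
    have h1 : (N.+1 <= 2 * N)%N by rewrite mul2n -addnn -addn1 leq_add2l.
    have h2 : (N <= 2 * T * z)%N.
      apply: ltnW; apply: leq_trans (ltn_ceil N T0) _; rewrite -/z mulnC.
      by rewrite -mulnA mulnCA leq_mul2l; apply/orP; right; rewrite mul2n -addnn -addn1 leq_add2l.
    apply: ltW; apply: lt_le_trans xN _; rewrite ler_nat (leq_trans h1) //.
    by rewrite -[4%N]/(2 * 2)%N -!mulnA leq_mul2l /= mulnA.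
  rewrite lerBlDl -ln_natM ?muln_gt0 // ler_ln ?posrE ?ltr0n ?muln_gt0 ?T0 //.
- exact: ln_nat_ge0.
- exact: ln_nat_ge0.
- exact: ln_nat_ge0.
- rewrite mulrC -ler_pdivrMr // -[leLHS]expRK ler_ln ?posrE // -/X1; lra.
- by rewrite -ler_pdivrMl // mulr1; lra.
- apply: le_trans rb; rewrite lerD2l ler_wpM2l // ler_wpM2l //.
    by move: d1 e1; clear; lra.
  by apply: hZ; apply: leq_trans zZ.
Qed.

Local Open Scope classical_set_scope.

Theorem mainTheorem4 (R : realType) (F : {poly int}) (g : nat)
    (sizeF : size F = g.+1) (g_ge2 : (2 <= g)%N)
    (irrF : irreducible_poly F) :
  exists o1 : R -> R,
    o1 x @[x --> +oo] --> 0 /\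
    \forall x \near +oo, forall y : R,
      x ^+ (g - 1) < y -> y <= x ^+ g ->
      let u := ln x / ln y in
      (1 + u - g%:R * u + o1 x) * x <= (Psi F x y)%:R.
Proof.
case: g => // n in sizeF g_ge2 *; rewrite subn1 /=.
pose d x y : R := (Psi F x y)%:R / x - (1 + ln x / ln y - n.+1%:R * (ln x / ln y)).
(* The error term is the infimum of the defects [d x y] over all admissible [y]. Adjoining 0 makes
   the set nonempty and the infimum nonpositive, so its limit only requires the lower bounds
   [low]. *)
pose S x := [set t | t = 0 \/ exists y, [/\ x ^+ n < y, y <= x ^+ n.+1 & t = d x y]] : set R.
have low (e : R) : 0 < e -> \forall x \near +oo, lbound (S x) (- e).
  (* [4 * eps <= e] gives the bound, and [1 / 8] keeps [eps] in the range of [Psi_lower]. *)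
  move=> e0; pose eps := Num.min (e / 4) (1 / 8).
  have eps01 : 0 < eps < 1 / 4.
    by rewrite lt_min divr_gt0 //= ?gt_min; apply/andP; split; [|apply/orP; right]; lra.
  have [X hX] := Psi_lower (R := R) g_ge2 sizeF irrF eps01.
  near=> x.
  have x0 : 0 < x by near: x; apply: nbhs_pinfty_gt; rewrite num_real.
  have Xx : X <= x by near: x; apply: nbhs_pinfty_ge; rewrite num_real.
  move=> t [->|[y [xy yx ->]]]; first by rewrite oppr_le0 ltW.
  have := hX x Xx y xy yx => /=; rewrite -ler_pdivlMr // /d => h.
  have : eps <= e / 4 by rewrite ge_min lexx.
  by move: h; clear; lra.
exists (fun x => inf (S x)); split.
- apply/cvgrPdist_le => e e0; near=> x.
  have lb : lbound (S x) (- e) by near: x; apply: low.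
  rewrite sub0r normrN ler_norml; apply/andP; split.
    by apply: lb_le_inf => //; exists 0; left.
  apply: (@le_trans _ _ 0); last exact: ltW.
  by apply: ge_inf; [exists (- e) | left].
- near=> x.
  have x0 : 0 < x by near: x; apply: nbhs_pinfty_gt; rewrite num_real.
  have lb : lbound (S x) (- 1) by near: x; apply: low.
  move=> y xy yx /=; rewrite -ler_pdivlMr // addrC -lerBrDr.
  by apply: ge_inf; [exists (- 1) | right; exists y].
Unshelve. all: by end_near.
Qed.
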